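(* Let $\eta$ be a composition and $1\le r\le n$. Let $A^{(r)}_{\eta\lambda^k}$, for compositions $\lambda^k$ of modulus $|\eta|+k$ with $1\le k\le r-1$, be the coefficients of $E^*_{\lambda^k}(z;q,t)$ in the expansion $$(e_r(z)-e_r(\overline{\eta}))\,E^*_\eta(z;q,t)=\sum_{|\eta|+1\le|\lambda|\le|\eta|+r}A^{(r)}_{\eta\lambda}\,E^*_\lambda(z;q,t).$$ Then the coefficients $A_{\eta\lambda^r}^{(r)}$ in the Pieri-type formula $$e_r(z)E_{\eta}(z;q^{-1},t^{-1})=\sum_{\substack{|\lambda^r|=|\eta|+r\\ \eta\preceq'\lambda^r\preceq'\eta+(1^n)}}A_{\eta\lambda^r}^{(r)}\,E_{\lambda^r}(z;q^{-1},t^{-1})$$ satisfy, for $\eta\preceq'\lambda^r\preceq'\eta+(1^n)$, $$A_{\eta\lambda^r}^{(r)}=\frac{(e_r(\overline{\lambda^r})-e_r(\overline{\eta}))E_\eta^*(\overline{\lambda^r})}{E_{\lambda^r}^*(\overline{\lambda^r})}-\sum_{k=1}^{r-1}\ \sum_{\lambda^k:\,\eta\preceq'\lambda^k\preceq'\lambda^r}A_{\eta\lambda^k}^{(r)}\frac{E^*_{\lambda^k}(\overline{\lambda^r})}{E_{\lambda^r}^*(\overline{\lambda^r})},$$ where the inner sum is over compositions $\lambda^k$ of modulus $|\eta|+k$.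
   Context: Fix $n\ge1$ and let $q,t$ be independent indeterminates; all polynomials are in $z=(z_1,\dots,z_n)$ with coefficients in $\mathbb{Q}(q,t)$. A composition is $\eta=(\eta_1,\dots,\eta_n)\in\mathbb{N}^n$ ($0\in\mathbb{N}$), with modulus $|\eta|=\sum_i\eta_i$; $\eta+(1^n)=(\eta_1+1,\dots,\eta_n+1)$. Put $l'_\eta(i)=\#\{j<i:\eta_j\ge\eta_i\}+\#\{j>i:\eta_j>\eta_i\}$, $\ \overline{\eta}_i=q^{\eta_i}t^{-l'_\eta(i)}$, $\ \overline{\eta}=(\overline{\eta}_1,\dots,\overline{\eta}_n)$. $e_r(z)=\sum_{1\le i_1<\dots<i_r\le n}z_{i_1}\cdots z_{i_r}$ is the $r$-th elementary symmetric function. The interpolation Macdonald polynomial $E^*_\eta(z)=E^*_\eta(z;q,t)$ is the unique polynomial of degree $\le|\eta|$ such that $E^*_\eta(\overline{\mu})=0$ for all compositions $\mu\ne\eta$ with $|\mu|\le|\eta|$, and whose coefficient of $z^\eta=z_1^{\eta_1}\cdots z_n^{\eta_n}$ is $1$; it satisfies $E^*_\eta(\overline{\eta})\ne0$. The nonsymmetric Macdonald polynomials $E_\eta(z)=E_\eta(z;q,t)$, homogeneous of degree $|\eta|$ with coefficient of $z^\eta$ equal to $1$, are defined recursively as follows. Let $s_i$ swap $z_i,z_{i+1}$ in functions and swap $\eta_i,\eta_{i+1}$ in compositions, let $\Phi\eta=(\eta_2,\dots,\eta_n,\eta_1+1)$, $T_i=t+\frac{tz_i-z_{i+1}}{z_i-z_{i+1}}(s_i-1)$,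 $T_i^{-1}=t^{-1}-1+t^{-1}T_i$, and $\Phi_q=z_nT_{n-1}^{-1}\cdots T_1^{-1}$. Then $E_{(0,\dots,0)}=1$; $\Phi_qE_\eta=t^{-\#\{i>1:\eta_i\le\eta_1\}}E_{\Phi\eta}$; and, for $\eta_i<\eta_{i+1}$, $T_iE_\eta=\frac{t-1}{1-\delta^{-1}}E_\eta+tE_{s_i\eta}$ with $\delta=\overline{\eta}_i/\overline{\eta}_{i+1}$. $E_\eta(z;q^{-1},t^{-1})$ is obtained by replacing $q,t$ by $q^{-1},t^{-1}$. (The top homogeneous component of $E^*_\eta(z;q,t)$ is $E_\eta(z;q^{-1},t^{-1})$.) Successor relation: $\eta\preceq'\lambda$ means there is a permutation $\sigma$ of $\{1,\dots,n\}$ such that $\eta_i<\lambda_{\sigma(i)}$ whenever $i<\sigma(i)$ and $\eta_i\le\lambda_{\sigma(i)}$ whenever $i\ge\sigma(i)$. *)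

(* Defs.v *)
From mathcomp Require Export all_boot all_fingroup all_algebra.
From mathcomp Require Export generic_quotient fraction.
From mathcomp.multinomials Require Export mpoly.

Set Implicit Arguments.
Unset Strict Implicit.
Unset Printing Implicit Defensive.

Import GRing.Theory.
Local Open Scope ring_scope.

(* A composition with n parts is an exponent vector eta : 'X_{1..n}, so that
   z^eta is 'X_[eta] and the modulus |eta| is mdeg eta.  Indices start at 0. *)

Definition swap_comp (n : nat) (i j : 'I_n) (eta : 'X_{1..n}) : 'X_{1..n} :=
  [multinom eta (tperm i j k) | k < n].

(* ordS is the cyclic successor: the last part is eta_1 + 1. *)
Definition Phi_comp (n : nat) (eta : 'X_{1..n.+1}) : 'X_{1..n.+1} :=
  [multinom (eta (ordS i) + (i == ord_max))%N | i < n.+1].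

Definition add_ones (n : nat) (eta : 'X_{1..n}) : 'X_{1..n} :=
  [multinom (eta i).+1 | i < n].

Definition leg' (n : nat) (eta : 'X_{1..n}) (i : 'I_n) : nat :=
  (#|[set j : 'I_n | (j < i) && (eta i <= eta j)]|
   + #|[set j : 'I_n | (i < j) && (eta i < eta j)]|)%N.

Definition succ' (n : nat) (eta la : 'X_{1..n}) : bool :=
  [exists s : 'S_n, [forall i : 'I_n,
     if (i < s i)%N then (eta i < la (s i))%N else (eta i <= la (s i))%N]].

Section Macdonald.

Variables (F : fieldType) (q t : F).

Definition spectrum (n : nat) (eta : 'X_{1..n}) (i : 'I_n) : F :=
  q ^+ eta i * t ^- leg' eta i.

Definition interpolation_Macdonald (n : nat) (eta : 'X_{1..n})
    (p : {mpoly F[n]}) : Prop :=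
  [/\ (msize p <= (mdeg eta).+1)%N,
      forall mu : 'X_{1..n}, mu != eta -> (mdeg mu <= mdeg eta)%N ->
        p.@[spectrum mu] = 0
    & p@_eta = 1].

Lemma divdiff_ex (n : nat) (i j : 'I_n) (p : {mpoly F[n]}) :
  exists d, ('X_i - 'X_j) * d == msym (tperm i j) p - p.
Proof.
pose D (x : {mpoly F[n]}) :=
  exists d : {mpoly F[n]}, ('X_i - 'X_j) * d = msym (tperm i j) x - x.
have DD x y : D x -> D y -> D (x + y).
  move=> [d1 E1] [d2 E2]; exists (d1 + d2).
  by rewrite mulrDr E1 E2 msymD opprD addrACA.
have DM x y : D x -> D y -> D (x * y).
  move=> [d1 E1] [d2 E2]; exists (d1 * msym (tperm i j) y + x * d2).
  by rewrite mulrDr mulrA E1 mulrCA E2 msymM mulrBl mulrBr addrA subrK.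
have DC c : D c%:MP by exists 0; rewrite mulr0 /msym mmapC subrr.
have DX k : D 'X_k.
  rewrite /D /msym mmapX mmap1U.
  case: tpermP => [->|->|_ _]; [exists (-1)|exists 1|exists 0].
  - by rewrite mulrN1 opprB.
  - by rewrite mulr1.
  - by rewrite mulr0 subrr.
have D1 : D 1 by rewrite -mpolyC1; apply: DC.
suff [d E] : D p by exists d; apply/eqP.
elim/mpolyind: p => [|c m p _ _ IH]; first by rewrite -mpolyC0; apply: DC.
apply: DD IH; rewrite -mul_mpolyC; apply: (DM _ _ (DC c)).
rewrite mpolyXE_id; elim/big_ind: _ => // k _.
by elim: (m k) => [|a IHa]; rewrite ?expr0 // exprS; apply: DM.
Qed.

(* (s_ij p - p) / (z_i - z_j); the quotient is unique when i != j. *)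
Definition divdiff (n : nat) (i j : 'I_n) (p : {mpoly F[n]}) : {mpoly F[n]} :=
  xchoose (divdiff_ex i j p).

Lemma divdiffP (n : nat) (i j : 'I_n) (p : {mpoly F[n]}) :
  ('X_i - 'X_j) * divdiff i j p = msym (tperm i j) p - p.
Proof. exact/eqP/(xchooseP (divdiff_ex i j p)). Qed.

(* T_i and its inverse act in n.+1 variables; for i : 'I_n the positions i and
   i+1 are widen_ord (leqnSn n) i and lift ord0 i. *)
Definition opT (n : nat) (i : 'I_n) (p : {mpoly F[n.+1]}) : {mpoly F[n.+1]} :=
  let a := widen_ord (leqnSn n) i in let b := lift ord0 i in
  t *: p + (t *: 'X_a - 'X_b) * divdiff a b p.

Definition opTinv (n : nat) (i : 'I_n) (p : {mpoly F[n.+1]}) :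
    {mpoly F[n.+1]} :=
  (t^-1 - 1) *: p + t^-1 *: opT i p.

(* foldl over enum 'I_n applies T_1^-1 first and T_(n-1)^-1 last. *)
Definition Phiq (n : nat) (p : {mpoly F[n.+1]}) : {mpoly F[n.+1]} :=
  'X_ord_max * foldl (fun f i => opTinv i f) p (enum 'I_n).

Definition nonsymmetric_Macdonald (n : nat)
    (E : 'X_{1..n.+1} -> {mpoly F[n.+1]}) : Prop :=
  [/\ forall eta, E eta \is (mdeg eta).-homog /\ (E eta)@_eta = 1,
      E 0%MM = 1,
      forall eta,
        Phiq (E eta)
        = t ^- #|[set i : 'I_n.+1 | (0 < i)%N && (eta i <= eta ord0)%N]|
            *: E (Phi_comp eta)
    & forall (eta : 'X_{1..n.+1}) (i : 'I_n),
        let a := widen_ord (leqnSn n) i in let b := lift ord0 i in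
        let delta := spectrum eta a / spectrum eta b in
        (eta a < eta b)%N ->
        opT i (E eta)
        = ((t - 1) / (1 - delta^-1)) *: E eta + t *: E (swap_comp a b eta)].

End Macdonald.

Definition Qqt : fieldType := {fraction {mpoly rat[2]}}.
Definition qvar : Qqt := tofrac ('X_ord0 : {mpoly rat[2]}).
Definition tvar : Qqt := tofrac ('X_ord_max : {mpoly rat[2]}).

Definition qt_eval_inv (p : {mpoly rat[2]}) : Qqt :=
  mmap (fun c : rat => tofrac c%:MP : Qqt)
       (fun i : 'I_2 => (tofrac 'X_i : Qqt)^-1) p.

(* The automorphism q |-> q^-1, t |-> t^-1 of Q(q,t), computed on the
   numerator and denominator of a representative. *)
Definition qt_inv (x : Qqt) : Qqt :=
  qt_eval_inv \n_(repr x) / qt_eval_inv \d_(repr x).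

Definition inv_params (n : nat) (p : {mpoly Qqt[n]}) : {mpoly Qqt[n]} :=
  map_mpoly qt_inv p.

(* Main.v *)
From HB Require Import structures.
Require Import Defs.
From mathcomp Require Import zify ring.

Set Implicit Arguments.
Unset Strict Implicit.
Unset Printing Implicit Defensive.

Import GRing.Theory.
Local Open Scope ring_scope.

Local Notation lo i := (widen_ord (leqnSn _) i).
Local Notation hi i := (lift ord0 i).

(** Let N be the number of variables, call the point [spectrum q t mu] the node
    of mu and write mu_i for its coordinates, E*_eta for the interpolation
    polynomials, E'_eta for E_eta(z; q^-1, t^-1), and <= for [succ'].

    Everything rests on interpolation: a polynomial of degree at most d is
    determined by its values at the nodes of modulus at most d
    ([vanishing_at_nodes]).  It shows at once that Hecke operators, and the
    raising operator that goes with eta |-> Phi eta, map each E*_eta to a short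
    combination of E*'s, since at a node these operators only see neighbouring
    nodes.

    The recursion for the coefficients is the expansion of
    (e_r - e_r(eta)) E*_eta evaluated at the node of la, where |la| = |eta| + r.
    Only A_la E*_la(la) and the terms A_mu E*_mu(la) with |eta| < |mu| < |la|
    survive, and among these only the ones with eta <= mu <= la.  Indeed E*_mu
    vanishes at la unless mu <= la ([extra_vanishing]), and then induction on
    the modulus and transitivity of the order give A_mu = 0 unless eta <= mu
    ([coef_lower]).

    For extra vanishing, (z_i - eta_i) E*_eta vanishes at all nodes of modulus
    at most |eta|, so it is a combination of the E*_nu with |nu| = |eta| + 1.
    Only nu with eta <= nu occur ([Es_vanish_next]), and one concludes by
    induction, choosing i such that eta_i and mu_i differ.  That restriction on
    nu comes, for i = 1, from an eigenvalue equation that writes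
    (z_1 / eta_1 - 1) E*_eta as inverse Hecke operators applied to a multiple of
    E*_(Phi eta): such operators reach only the nodes that are obtained from
    Phi eta by a subword of the swaps s_1 ... s_(N-1), and all of these are
    successors of eta ([succ_subword_Phi]).  For the other i one conjugates by
    the raising operator, as eta |-> Phi eta preserves the order.

    The top degree part of the eigenvalue equation identifies the raising
    operator z_N f(z_N / q, z_1, ..., z_(N-1)) with the operator Phi_q on the
    top components, so these obey the recursion that defines E'
    ([top_component]).  Hence the top degree part of the expansion is the Pieri
    formula for E', except for the upper bound la <= eta + (1^N).

    For the upper bound, e_N E'_eta is a multiple of E'_(eta + 1^N).  The monomial
    multiple z_J E'_eta arises from it by dividing by the variables outside J.
    Division by a variable preserves the span of the E'_la with la <= ka
    ([below_div_X]), because for z_1 it is governed by the same subwords, read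
    backwards.  Therefore e_r E'_eta lies in the span for ka = eta + 1^N
    ([below_mesym]).

    The argument works over any field in which the monomials in q and t are
    pairwise distinct.  The last part checks this for Q(q,t) and transports the
    recursion for E along q |-> q^-1, t |-> t^-1. *)

(** * Substitution in polynomials and degree bounds *)

Section Substitution.

Variable F : fieldType.

Lemma mpoly_ring_ind n (P : {mpoly F[n]} -> Prop) :
    (forall c, P c%:MP) -> (forall i, P 'X_i) ->
    (forall p p', P p -> P p' -> P (p + p')) ->
    (forall p p', P p -> P p' -> P (p * p')) ->
  forall p, P p.
Proof.
move=> PC PX PD PM p.
have P1 : P 1 by rewrite -mpolyC1; apply: PC.
elim/mpolyind: p => [|c m p _ _ IH]; first by rewrite -mpolyC0; apply: PC.
apply: PD _ IH; rewrite -mul_mpolyC; apply: (PM _ _ (PC c)).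
rewrite mpolyXE_id; elim/big_ind: _ => // k _.
by elim: (m k) => [|a IHa]; rewrite ?expr0 // exprS; apply: PM.
Qed.

Lemma msizeM_pred n (p p' : {mpoly F[n]}) :
  (msize (p * p') <= (msize p + msize p').-1)%N.
Proof.
have [->|p0] := eqVneq p 0; first by rewrite mul0r msize0.
have [->|p'0] := eqVneq p' 0; first by rewrite mulr0 msize0.
by rewrite msizeM.
Qed.

(** Substitution of arbitrary polynomials for the variables; [msym s] is the
    instance [fun i => 'X_(s i)] by conversion, which lets permutations,
    specializations and scalings share the lemmas below. *)
Definition subst n k (h : 'I_n -> {mpoly F[k]}) (p : {mpoly F[n]}) :
  {mpoly F[k]} := mmap (@mpolyC k F) h p.

Section Laws.
Variables (n k : nat) (h : 'I_n -> {mpoly F[k]}).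
Implicit Types p : {mpoly F[n]}.

Lemma substC c : subst h c%:MP = c%:MP. Proof. exact: mmapC. Qed.
Lemma substX i : subst h 'X_i = h i. Proof. by rewrite /subst mmapX mmap1U. Qed.
Lemma substD p p' : subst h (p + p') = subst h p + subst h p'.
Proof. exact: mmapD. Qed.
Lemma substB p p' : subst h (p - p') = subst h p - subst h p'.
Proof. exact: mmapB. Qed.
Lemma substM p p' : subst h (p * p') = subst h p * subst h p'.
Proof. exact: rmorphM. Qed.
Lemma substZ c p : subst h (c *: p) = c *: subst h p.
Proof. by rewrite -!mul_mpolyC substM substC. Qed.

Lemma meval_subst p v : (subst h p).@[v] = p.@[fun i => (h i).@[v]].
Proof.
elim/mpoly_ring_ind: p => [c|i|p p' IH IH'|p p' IH IH'].
- by rewrite substC !mevalC.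
- by rewrite substX mevalXU.
- by rewrite substD !mevalD IH IH'.
- by rewrite substM !mevalM IH IH'.
Qed.

Lemma eq_subst (h' : 'I_n -> {mpoly F[k]}) p : h =1 h' -> subst h p = subst h' p.
Proof.
move=> e; rewrite /subst /mmap; apply: eq_bigr => m _; congr (_ * _).
exact: mmap1_eq.
Qed.

Lemma msize_subst p :
  (forall i, (msize (h i) <= 2)%N) -> (msize (subst h p) <= msize p)%N.
Proof.
move=> hh; rewrite [in subst h p](mpolyE p) /subst raddf_sum /=.
apply: leq_trans (msize_sum _ _ _) _; apply/bigmax_leqP_seq => m hm _.
rewrite -/(subst h _) substZ; apply: leq_trans (msizeZ_le _ _) _.
apply: leq_trans (msize_mdeg_lt hm); rewrite /subst mmapX /mmap1 mdegE.
elim/big_ind2: _ => [|x a y b|i _].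
- by rewrite msize1.
- by move=> Hx Hy; apply: leq_trans (msizeM_pred x y) _; lia.
- elim: (m i) => [|a IH]; first by rewrite expr0 msize1.
  by rewrite exprS; apply: leq_trans (msizeM_pred _ _) _; move: (hh i) IH; lia.
Qed.

End Laws.

Lemma subst_cong n k (h h' : 'I_n -> {mpoly F[k]}) w p :
    (forall i, exists d, h i - h' i = w * d) ->
  exists d, subst h p - subst h' p = w * d.
Proof.
move=> hh; elim/mpoly_ring_ind: p => [c|i|p p' [d E] [d' E']|p p' [d E] [d' E']].
- by exists 0; rewrite !substC subrr mulr0.
- by rewrite !substX.
- by exists (d + d'); rewrite mulrDr -E -E' !substD opprD addrACA.
- exists (d * subst h p' + subst h' p * d').
  by rewrite mulrDr mulrA -E mulrCA -E' !substM mulrBl mulrBr addrA subrK.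
Qed.

Lemma subst_subst n k l (h : 'I_n -> {mpoly F[k]}) (g : 'I_k -> {mpoly F[l]}) p :
  subst g (subst h p) = subst (fun i => subst g (h i)) p.
Proof.
elim/mpoly_ring_ind: p => [c|i|p p' IH IH'|p p' IH IH'].
- by rewrite !substC.
- by rewrite !substX.
- by rewrite !substD IH IH'.
- by rewrite !substM IH IH'.
Qed.

Lemma subst_id n (p : {mpoly F[n]}) : subst (fun i => 'X_i) p = p.
Proof.
elim/mpoly_ring_ind: p => [c|i|p p' IH IH'|p p' IH IH'].
- by rewrite substC.
- by rewrite substX.
- by rewrite substD IH IH'.
- by rewrite substM IH IH'.
Qed.

Lemma msize_leP n (p : {mpoly F[n]}) k :
  reflect (forall m, (k <= mdeg m)%N -> p@_m = 0) (msize p <= k)%N.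
Proof.
apply: (iffP idP) => [hp m hm|hp].
  by apply: memN_msupp_eq0; apply: msize_mdeg_ge; apply: leq_trans hm.
rewrite msizeE; apply/bigmax_leqP_seq => m hm _; rewrite ltnNge.
by apply/negP => /hp; apply/eqP; rewrite -mcoeff_msupp.
Qed.

Lemma msize_cofactor n (p h : {mpoly F[n]}) d :
  msize p = 2 -> (msize (p * h) <= d.+1)%N -> (msize h <= d)%N.
Proof.
move=> hp; have [->|h0] := eqVneq h 0; first by rewrite mulr0 msize0.
have p0 : p != 0 by rewrite -msize_poly_eq0 hp.
by rewrite msizeM // hp.
Qed.

Lemma msize_XsubC n (i : 'I_n) c : msize ('X_i - c%:MP : {mpoly F[n]}) = 2.
Proof.
apply/eqP; rewrite eqn_leq; apply/andP; split.
  apply: leq_trans (msizeD_le _ _) _; rewrite geq_max msizeN msizeX mdeg1 /=.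
  by rewrite msizeC; case: (c != 0).
rewrite ltnNge; apply/negP => /msize_leP /(_ U_(i)%MM).
rewrite mdeg1 mcoeffB mcoeffXU mcoeffC eqxx mnm1_eq0 mulr0 subr0 => /(_ isT).
by move/eqP; rewrite oner_eq0.
Qed.

Lemma msize_XsubX n (i j : 'I_n) : i != j ->
  msize ('X_i - 'X_j : {mpoly F[n]}) = 2.
Proof.
move=> ij; apply/eqP; rewrite eqn_leq; apply/andP; split.
  by apply: leq_trans (msizeD_le _ _) _; rewrite msizeN !msizeX !mdeg1.
rewrite ltnNge; apply/negP => /msize_leP /(_ U_(i)%MM).
rewrite mdeg1 mcoeffB !mcoeffXU eqxx eq_sym (negbTE ij) subr0 => /(_ isT).
by move/eqP; rewrite oner_eq0.
Qed.

Lemma msizeM_bound n (p h : {mpoly F[n]}) a b :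
  (msize p <= a.+1)%N -> (msize h <= b)%N -> (msize (p * h) <= a + b)%N.
Proof. by move=> hp hh; apply: leq_trans (msizeM_pred _ _) _; move: hp hh; lia. Qed.

Lemma msizeMX_le n (p h : {mpoly F[n]}) d :
  (msize p <= 2)%N -> (msize h <= d)%N -> (msize (p * h) <= d.+1)%N.
Proof.
by move=> hp hh; apply: leq_trans (msizeM_pred _ _) _; move: hp hh; lia.
Qed.

Lemma msizeB_le n (p p' : {mpoly F[n]}) d :
  (msize p <= d)%N -> (msize p' <= d)%N -> (msize (p - p') <= d)%N.
Proof.
by move=> h h'; apply: leq_trans (msizeD_le _ _) _; rewrite geq_max msizeN h.
Qed.

Lemma msizeDl_le n (p p' : {mpoly F[n]}) d :
  (msize p <= d)%N -> (msize p' <= d)%N -> (msize (p + p') <= d)%N.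
Proof.
by move=> h h'; apply: leq_trans (msizeD_le _ _) _; rewrite geq_max h.
Qed.

Lemma meval_sum n I (r : seq I) (P : pred I) (G : I -> {mpoly F[n]}) v :
  (\sum_(i <- r | P i) G i).@[v] = \sum_(i <- r | P i) (G i).@[v].
Proof. exact: raddf_sum. Qed.

End Substitution.

(** * Legs, rotation and swaps of compositions *)

Section Compositions.

(** Sorting the positions by decreasing parts, with ties kept in order, [leg']
    counts the positions that come before a given one. *)
Definition beats n (eta : 'X_{1..n}) (i j : 'I_n) : bool :=
  ((j < i) && (eta i <= eta j))%N || ((i < j) && (eta i < eta j))%N.

Lemma leg'E n (eta : 'X_{1..n}) i : leg' eta i = #|[set j | beats eta i j]|.
Proof.
rewrite /leg' -cardsUI [X in (_ + X)%N](_ : _ = 0%N) ?addn0; last first.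
  apply/eqP; rewrite cards_eq0; apply/eqP/setP => j; rewrite !inE.
  by apply/negP => /andP[/andP[h _] /andP[h' _]]; move: h h'; lia.
by apply: eq_card => j; rewrite !inE.
Qed.

Lemma leg'_reindex n (mu eta : 'X_{1..n}) (f : 'I_n -> 'I_n) :
    injective f -> forall i,
    (forall j, beats mu i j = beats eta (f i) (f j)) ->
  leg' mu i = leg' eta (f i).
Proof.
move=> finj i h; rewrite !leg'E.
rewrite -[RHS](@on_card_preimset _ _ f); first by apply: eq_card => j; rewrite !inE h.
by have [g gK Kg] := injF_bij finj; exists g => j _; rewrite ?gK ?Kg.
Qed.

Section Succ.
Variable n : nat.
Implicit Types eta mu nu : 'X_{1..n.+1}.

Lemma val_ordS (i : 'I_n.+1) :
  (ordS i : nat) = if i == ord_max then 0%N else i.+1.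
Proof.
case: ifP => [/eqP ->|h] /=; first by rewrite modnn.
by rewrite modn_small // ltnS ltn_neqAle -ltnS ltn_ord andbT; move: h; rewrite -val_eqE /= => ->.
Qed.

Lemma ordS_max : ordS (ord_max : 'I_n.+1) = ord0.
Proof. by apply: ord_inj; rewrite val_ordS eqxx. Qed.

Lemma ordS_lo (i : 'I_n) : ordS (lo i) = hi i.
Proof.
apply: ord_inj; rewrite val_ordS /= /bump /= add1n.
by rewrite -val_eqE /= ltn_eqF.
Qed.

Lemma ord_lo_or_max (j : 'I_n.+1) : (exists i : 'I_n, j = lo i) \/ j = ord_max.
Proof.
have [h|h] := ltnP j n; [left; exists (Ordinal h) | right]; apply: val_inj => //=.
by apply/eqP; rewrite eqn_leq h -ltnS ltn_ord.
Qed.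

Lemma Phi_compE eta i : Phi_comp eta i = (eta (ordS i) + (i == ord_max))%N.
Proof. by rewrite mnmE. Qed.

Lemma mdeg_Phi eta : mdeg (Phi_comp eta) = (mdeg eta).+1.
Proof.
rewrite !mdegE (eq_bigr _ (fun i _ => Phi_compE eta i)) big_split /=.
rewrite [X in (_ + X)%N](bigD1 (ord_max : 'I_n.+1)) //= eqxx.
rewrite [X in (_ + (_ + X))%N]big1 => [|i /negbTE -> //].
by rewrite [in RHS](reindex_inj (@ordS_inj n.+1)) addn1.
Qed.

Definition Phi_pred eta : 'X_{1..n.+1} :=
  [multinom (eta (ord_pred i) - (i == ord0))%N | i < n.+1].

Lemma Phi_predK eta : (0 < eta ord_max)%N -> Phi_comp (Phi_pred eta) = eta.
Proof.
move=> h; apply/mnmP => i; rewrite Phi_compE mnmE ordSK.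
rewrite -ordS_max (inj_eq (@ordS_inj n.+1)).
by have [->|_] := eqVneq i ord_max; lia.
Qed.

Lemma beats_Phi eta i j :
  beats (Phi_comp eta) i j = beats eta (ordS i) (ordS j).
Proof.
rewrite /beats !Phi_compE !val_ordS.
have Hi := ltn_ord i; have Hj := ltn_ord j.
have [->|ni] := eqVneq i ord_max; have [->|nj] := eqVneq j ord_max => /=;
  rewrite ?addn0 ?addn1 //; try (move: ni; rewrite -val_eqE /=);
  try (move: nj; rewrite -val_eqE /=); lia.
Qed.

Lemma leg'_Phi eta i : leg' (Phi_comp eta) i = leg' eta (ordS i).
Proof. by apply: leg'_reindex => [|j]; [exact: ordS_inj | exact: beats_Phi]. Qed.

Definition succ_cond (eta mu : 'X_{1..n.+1}) (i j : 'I_n.+1) : bool :=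
  (eta i + (i < j)%N <= mu j)%N.

Lemma succP eta mu :
  reflect (exists s : 'S_n.+1, forall i, succ_cond eta mu i (s i)) (succ' eta mu).
Proof.
have E (s : 'S_n.+1) (i : 'I_n.+1) : (if (i < s i)%N then (eta i < mu (s i))%N
    else (eta i <= mu (s i))%N) = succ_cond eta mu i (s i).
  by rewrite /succ_cond; case: (i < s i)%N; rewrite ?addn1 ?addn0.
apply: (iffP existsP) => -[s h]; exists s.
  by move=> i; move/forallP: h => /(_ i); rewrite E.
by apply/forallP => i; rewrite E.
Qed.

Lemma succ_refl eta : succ' eta eta.
Proof. by apply/succP; exists 1%g => i; rewrite perm1 /succ_cond ltnn addn0. Qed.

(** When i < u (s i), one of the two steps i -> s i -> u (s i) goes up, and its
    inequality is strict. *)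
Lemma succ_trans mu eta nu : succ' eta mu -> succ' mu nu -> succ' eta nu.
Proof.
move=> /succP[s hs] /succP[u hu]; apply/succP; exists (s * u)%g => i.
rewrite permM; move: (hs i) (hu (s i)); rewrite /succ_cond.
by have [] := ltnP i (s i); have [] := ltnP (s i) (u (s i));
  have [] := ltnP i (u (s i)); lia.
Qed.

(** Only comparisons with the last position change: a strict inequality towards
    it becomes a weak one, which the added 1 makes up for, and conversely. *)
Lemma succ_cond_Phi eta mu i j :
  succ_cond (Phi_comp eta) (Phi_comp mu) i j = succ_cond eta mu (ordS i) (ordS j).
Proof.
rewrite /succ_cond !Phi_compE !val_ordS.
have Hi := ltn_ord i; have Hj := ltn_ord j.
have [->|ni] := eqVneq i ord_max; have [->|nj] := eqVneq j ord_max => /=;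
  rewrite ?addn0 ?addn1 //; try (move: ni; rewrite -val_eqE /=);
  try (move: nj; rewrite -val_eqE /=); lia.
Qed.

Lemma succ_Phi eta mu : succ' (Phi_comp eta) (Phi_comp mu) = succ' eta mu.
Proof.
pose c : 'S_n.+1 := perm (@ordS_inj n.+1).
have cE i : c i = ordS i by rewrite permE.
apply/succP/succP => -[s h].
  exists (c^-1 * s * c)%g => i; move: (h (c^-1 i)%g).
  by rewrite succ_cond_Phi !permM -!cE permKV.
exists (c * s * c^-1)%g => i; rewrite succ_cond_Phi !permM.
by rewrite -!cE permKV; apply: h.
Qed.

Lemma mdeg_add_ones eta : mdeg (add_ones eta) = (mdeg eta + n.+1)%N.
Proof.
rewrite !mdegE (eq_bigr (fun i => eta i + 1)%N) => [|i _]; last first.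
  by rewrite mnmE addn1.
by rewrite big_split /= sum_nat_const card_ord muln1.
Qed.

Definition sw (i : 'I_n) eta : 'X_{1..n.+1} := swap_comp (lo i) (hi i) eta.

Lemma swE i eta k : sw i eta k = eta (tperm (lo i) (hi i) k).
Proof. by rewrite mnmE. Qed.

Lemma swK i : involutive (sw i).
Proof. by move=> eta; apply/mnmP => k; rewrite !swE tpermK. Qed.

Lemma mdeg_sw i eta : mdeg (sw i eta) = mdeg eta.
Proof.
rewrite !mdegE (eq_bigr _ (fun k _ => swE i eta k)).
by rewrite [RHS](reindex_inj (@perm_inj _ (tperm (lo i) (hi i)))).
Qed.

Lemma lo_neq_hi (i : 'I_n) : lo i != hi i.
Proof. by rewrite -val_eqE /= /bump; lia. Qed.

Lemma sw_lo i eta : sw i eta (lo i) = eta (hi i).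
Proof. by rewrite swE tpermL. Qed.
Lemma sw_hi i eta : sw i eta (hi i) = eta (lo i).
Proof. by rewrite swE tpermR. Qed.
Lemma sw_D i eta k : k != lo i -> k != hi i -> sw i eta k = eta k.
Proof. by move=> h h'; rewrite swE tpermD // eq_sym. Qed.

Lemma beats_sw i eta : eta (lo i) != eta (hi i) -> forall j k,
  beats (sw i eta) j k =
  beats eta (tperm (lo i) (hi i) j) (tperm (lo i) (hi i) k).
Proof.
move=> ne j k; rewrite /beats !swE.
have Hl : (lo i : nat) = i by [].
have Hh : (hi i : nat) = i.+1 by rewrite /= /bump.
case: (tpermP (lo i) (hi i) j) => [->|->|/eqP jl /eqP jh];
case: (tpermP (lo i) (hi i) k) => [->|->|/eqP kl /eqP kh]; rewrite ?ltnn ?Hl ?Hh //=;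
 try (move: jl jh; rewrite -!val_eqE /= /bump);
 try (move: kl kh; rewrite -!val_eqE /= /bump); move: ne; try lia.
Qed.

Lemma leg'_sw i eta : eta (lo i) != eta (hi i) -> forall k,
  leg' (sw i eta) k = leg' eta (tperm (lo i) (hi i) k).
Proof.
by move=> ne k; apply: leg'_reindex => [|j]; [exact: perm_inj | exact: beats_sw].
Qed.

Lemma leg'_hi i eta : eta (lo i) = eta (hi i) ->
  leg' eta (hi i) = (leg' eta (lo i)).+1.
Proof.
move=> e; rewrite !leg'E.
have Hl : (lo i : nat) = i by [].
have Hh : (hi i : nat) = i.+1 by rewrite /= /bump.
rewrite (_ : [set j | beats eta (hi i) j] = lo i |: [set j | beats eta (lo i) j]).
  by rewrite cardsU1 inE /beats ltnn /= add1n.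
apply/setP => j; rewrite !inE /beats -e Hl Hh.
have [->|/eqP jl] := eqVneq j (lo i); first by rewrite Hl; lia.
have [->|/eqP jh] := eqVneq j (hi i); first by rewrite Hh -e; lia.
have {}jl : (j : nat) <> i by move=> h; apply: jl; apply: val_inj.
have {}jh : (j : nat) <> i.+1 by move=> h; apply: jh; apply: ord_inj; rewrite h Hh.
lia.
Qed.

Lemma leg'_max eta : eta ord_max = 0%N -> leg' eta ord_max = n.
Proof.
move=> e; rewrite leg'E /beats e.
rewrite (_ : [set _ | _] = ~: [set ord_max]).
  by have := cardsC [set ord_max : 'I_n.+1]; rewrite cards1 card_ord add1n => -[].
apply/setP => j; rewrite !inE -val_eqE /=; have := ltn_ord j; lia.
Qed.

(** A final part 0 comes before no other position, so the remaining parts have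
    the legs of the shorter composition. *)
Lemma leg'_widen eta (mu : 'X_{1..n}) : eta ord_max = 0%N ->
  (forall i : 'I_n, eta (lo i) = mu i) -> forall i, leg' eta (lo i) = leg' mu i.
Proof.
move=> e0 em i; rewrite !leg'E.
have wi : injective (widen_ord (leqnSn n)) by move=> x y /(congr1 val) /= /val_inj.
rewrite -[RHS](card_imset _ wi).
apply: eq_card => j; rewrite inE; apply/idP/imsetP => [|[k + ->]].
  have [[k ->]|->] := ord_lo_or_max j.
    by exists k => //; rewrite inE /beats -!em.
  by rewrite /beats e0 ltn0 andbF orbF /= ltnNge ltnW.
by rewrite inE /beats !em.
Qed.

(** A Hecke operator for the i-th swap, evaluated at the node of [mu], sees the
    values at [mu] and [sw i mu] only.  Hence a word of such operators sees the
    values at the compositions related to [mu] by [subword]. *)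
Fixpoint subword (s : seq 'I_n) mu nu : Prop :=
  if s is i :: s' then subword s' mu nu \/ subword s' (sw i mu) nu
  else mu = nu.

Lemma subword_cat s s' mu nu :
  subword (s ++ s') mu nu <-> exists2 ka, subword s mu ka & subword s' ka nu.
Proof.
elim: s mu => [|i s IH] mu /=; first by split=> [h|[ka -> //]]; exists mu.
split=> [[/IH|/IH] [ka h h']|[ka [h|h] h']].
- by exists ka => //; left.
- by exists ka => //; right.
- by left; apply/IH; exists ka.
- by right; apply/IH; exists ka.
Qed.

Lemma subword_rev s mu nu : subword s mu nu -> subword (rev s) nu mu.
Proof.
elim: s mu => [|i s IH] mu /=; first by move->.
rewrite rev_cons -cats1 => -[/IH h|/IH h]; apply/subword_cat.
  by exists mu => //; left.
by exists (sw i mu) => //; right; rewrite swK.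
Qed.

Lemma mdeg_subword s mu nu : subword s mu nu -> mdeg nu = mdeg mu.
Proof. by elim: s mu => [|i s IH] mu /= => [->|[/IH|/IH ->]] //; rewrite mdeg_sw. Qed.

(** The swaps are treated from the last to the first.  Before the swap of the
    positions k - 1 and k, a part is carried at position k: it is eta_0 + 1, or a
    part that took its place when a swap was left out.  The parts in front of it
    are still those of eta shifted by one, and the positions behind it are
    final.  The permutation [u] sends a final position to the position in eta
    that its part comes from; its value at 0 is the origin of the carried part,
    which ends at 0 if all remaining swaps are performed.  If that origin is not
    behind k, then the carried part has been increased, which leaves room for
    dropping it at a position further right. *)
Let stage eta k nu :=
  (forall p : 'I_n, (p < k)%N -> nu (lo p) = eta (hi p)) /\
  exists u : 'S_n.+1,
  [/\ forall p : 'I_n.+1, (0 < p <= k)%N -> u p = p,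
      forall p : 'I_n.+1, (k < p)%N -> succ_cond eta nu (u p) p
    & (eta (u ord0) + (u ord0 <= k) <= nu (inord k))%N].

Lemma stage_sw eta (k : 'I_n) nu : stage eta k.+1 nu -> stage eta k (sw k nu).
Proof.
have Hl : (lo k : nat) = k by [].
have Hh : (hi k : nat) = k.+1 by rewrite /= /bump.
have il : inord k = lo k by apply: val_inj; rewrite /= inordK // ltnS ltnW.
have ih : inord k.+1 = hi k by apply: val_inj; rewrite /= inordK // ltnS.
case=> h1 [u [h2 h3 h4]]; split.
  move=> p pk; rewrite sw_D; first by apply: h1; lia.
    by rewrite -val_eqE /=; lia.
  by rewrite -val_eqE /= /bump; lia.
exists u; split.
- by move=> p hp; apply: h2; lia.
- move=> p; rewrite leq_eqVlt => /predU1P[e|hp]; last first.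
    move: (h3 p hp); rewrite /succ_cond sw_D //; rewrite -val_eqE /= /bump; lia.
  have -> : p = hi k by apply: ord_inj; rewrite -e Hh.
  have uh : u (hi k) = hi k by apply: h2; rewrite Hh leqnn.
  by rewrite uh /succ_cond sw_hi ltnn addn0 h1.
- by rewrite il sw_lo -ih; apply: leq_trans h4; rewrite leq_add2l; lia.
Qed.

Lemma stage_keep eta (k : 'I_n) nu : stage eta k.+1 nu -> stage eta k nu.
Proof.
have Hl : (lo k : nat) = k by [].
have Hh : (hi k : nat) = k.+1 by rewrite /= /bump.
have il : inord k = lo k by apply: val_inj; rewrite /= inordK // ltnS ltnW.
have ih : inord k.+1 = hi k by apply: val_inj; rewrite /= inordK // ltnS.
case=> h1 [u [h2 h3 h4]]; split; first by move=> p pk; apply: h1; lia.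
have h0 : ord0 != hi k :> 'I_n.+1 by rewrite -val_eqE.
exists (tperm ord0 (hi k) * u)%g; split.
- move=> p hp; rewrite permM tpermD; first by apply: h2; lia.
    by rewrite -val_eqE /=; lia.
  by rewrite -val_eqE /= /bump; lia.
- move=> p; rewrite leq_eqVlt permM => /predU1P[e|hp].
    have -> : p = hi k by apply: ord_inj; rewrite -e Hh.
    by rewrite tpermR /succ_cond -[X in nu X]ih Hh; move: h4; lia.
  rewrite tpermD; first by apply: h3.
    by rewrite -val_eqE /=; lia.
  by rewrite -val_eqE /= /bump; lia.
- have uh : u (hi k) = hi k by apply: h2; rewrite Hh leqnn.
  by rewrite permM tpermL uh il h1 // Hh ltnn addn0.
Qed.

(** Performing all swaps adds 1 to the first part; each omitted swap exchanges
    the carried part with a part that then moves left, which costs only a weak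
    inequality. *)
Lemma succ_subword_Phi eta nu :
  subword (rev (enum 'I_n)) (Phi_comp eta) nu -> succ' eta nu.
Proof.
have start : stage eta n (Phi_comp eta).
  split=> [p _|]; first by rewrite Phi_compE ordS_lo -val_eqE /= ltn_eqF ?addn0.
  exists 1%g; split=> [p _|p|]; rewrite ?perm1 //.
    by move=> hp; have := ltn_ord p; lia.
  have -> : inord n = ord_max :> 'I_n.+1 by apply: val_inj; rewrite /= inordK.
  by rewrite Phi_compE ordS_max eqxx.
suff fin : forall k, (k <= n)%N -> forall mu, stage eta k mu ->
    subword (rev (take k (enum 'I_n))) mu nu -> stage eta 0 nu.
  rewrite -[enum 'I_n](@take_oversize _ n); last by rewrite size_enum_ord.
  move=> /(fin n (leqnn n) _ start)[_ [u [_ h3 h4]]].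
  apply/succP; exists (u^-1)%g => i.
  have := h3 (u^-1 i)%g; rewrite permKV; case: (ltnP 0 (u^-1 i)%g) => [_ /(_ isT)//|h _].
  have e : (u^-1 i)%g = ord0 by apply: val_inj; apply/eqP; rewrite -leqn0.
  have ei : i = u ord0 by rewrite -e permKV.
  rewrite e /succ_cond ltn0 addn0 ei; apply: leq_trans (leq_addr _ _) _.
  by apply: leq_trans h4 _; rewrite (_ : inord 0 = ord0) //; apply: val_inj; rewrite /= inordK.
elim=> [_ mu h /=|k IH kn mu h]; first by rewrite take0 /= => <-.
pose i := Ordinal kn.
rewrite (take_nth i) ?size_enum_ord // rev_rcons.
have -> : nth i (enum 'I_n) k = i by rewrite -[k]/(val i) nth_ord_enum.
case; apply: IH; rewrite ?(ltnW kn) //.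
  exact: (@stage_keep eta i).
exact: (@stage_sw eta i).
Qed.

End Succ.
End Compositions.

(** * Nodes and interpolation *)

Section Spectrum.

Variables (F : fieldType) (q t : F).
Hypotheses (q0 : q != 0) (t0 : t != 0).
Hypothesis qt_indep : forall a b c d : nat,
  q ^+ a * t ^+ b = q ^+ c * t ^+ d -> a = c /\ b = d.

Local Notation sp := (spectrum q t).

Lemma qtV_indep a b c d :
  q ^+ a * t ^- b = q ^+ c * t ^- d -> a = c /\ b = d.
Proof.
move=> e; have /qt_indep[-> ->] // : q ^+ a * t ^+ d = q ^+ c * t ^+ b.
apply: (@mulIf _ (t ^- b * t ^- d)); first by rewrite mulf_neq0 // invr_neq0 // expf_neq0.
by rewrite mulrACA e divff ?expf_neq0 // mulr1 mulrA mulfK // expf_neq0.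
Qed.

Lemma sp_neq0 n (eta : 'X_{1..n}) i : sp eta i != 0.
Proof. by rewrite mulf_neq0 ?invr_neq0 // expf_neq0. Qed.

Lemma sp_inj n (eta mu : 'X_{1..n}) : sp eta =1 sp mu -> eta = mu.
Proof. by move=> e; apply/mnmP => i; have [] := qtV_indep (e i). Qed.

Lemma sp_separates n (eta mu : 'X_{1..n}) :
  eta != mu -> exists i, sp eta i != sp mu i.
Proof.
move=> ne; apply/existsP; apply: contraNT ne; rewrite negb_exists => /forallP h.
by apply/eqP/sp_inj => i; apply/eqP; rewrite -[_ == _]negbK.
Qed.

Section Positive.
Variable n : nat.
Implicit Types eta mu nu : 'X_{1..n.+1}.

Lemma sp_Phi eta i : sp (Phi_comp eta) i = q ^+ (i == ord_max) * sp eta (ordS i).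
Proof. by rewrite /spectrum Phi_compE leg'_Phi exprD mulrCA mulrA. Qed.

Lemma sp_sw i eta : eta (lo i) != eta (hi i) -> forall k,
  sp (sw i eta) k = sp eta (tperm (lo i) (hi i) k).
Proof. by move=> ne k; rewrite /spectrum swE leg'_sw. Qed.

Lemma sp_lo i eta : eta (lo i) = eta (hi i) -> sp eta (lo i) = t * sp eta (hi i).
Proof.
move=> e; rewrite /spectrum leg'_hi // e exprS invfM.
by rewrite [RHS]mulrCA (mulrA t) divff // mul1r.
Qed.

Lemma sp_lo_neq_hi i eta : sp eta (lo i) != sp eta (hi i).
Proof.
apply/eqP => /qtV_indep[e]; rewrite leg'_hi // => /eqP.
by rewrite eqn_leq ltnn andbF.
Qed.

Lemma sp_max0 eta : eta ord_max = 0%N -> sp eta ord_max = t ^- n.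
Proof. by move=> e; rewrite /spectrum e leg'_max // mul1r. Qed.

Lemma sp_max_neq eta : (0 < eta ord_max)%N -> sp eta ord_max != t ^- n.
Proof.
move=> h; apply/eqP; rewrite -[RHS]mul1r -(expr0 q) => /qtV_indep[e _].
by rewrite e in h.
Qed.

Lemma Phi_max eta : (0 < Phi_comp eta ord_max)%N.
Proof. by rewrite Phi_compE eqxx addn1. Qed.

(** The substitution f(z) |-> f(z_N / q, z_1, ..., z_(N-1)): composition with the
    inverse of the map that sends the node of [eta] to that of [Phi_comp eta]. *)
Definition shift (p : {mpoly F[n.+1]}) : {mpoly F[n.+1]} :=
  subst (fun i => q^-1 ^+ (i == ord0) *: 'X_(ord_pred i)) p.

Definition unshift (p : {mpoly F[n.+1]}) : {mpoly F[n.+1]} :=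
  subst (fun i => q ^+ (i == ord_max) *: 'X_(ordS i)) p.

Lemma ord_pred_eq_max (i : 'I_n.+1) : (ord_pred i == ord_max) = (i == ord0).
Proof. by rewrite -(inj_eq (@ordS_inj n.+1)) ordS_max ord_predK. Qed.

Lemma ordS_eq0 (i : 'I_n.+1) : (ordS i == ord0) = (i == ord_max).
Proof. by rewrite -ord_pred_eq_max ordSK. Qed.

Lemma unshiftK : cancel unshift shift.
Proof.
move=> p; rewrite /shift /unshift subst_subst -[RHS]subst_id; apply: eq_subst => i.
rewrite substZ substX scalerA ordS_eq0 ordSK -exprMn divff // expr1n.
by rewrite scale1r.
Qed.

Lemma meval_unshift p eta : (unshift p).@[sp eta] = p.@[sp (Phi_comp eta)].
Proof.
rewrite meval_subst; apply: meval_eq => i.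
by rewrite mevalZ mevalXU sp_Phi.
Qed.

Lemma meval_shift p eta : (shift p).@[sp (Phi_comp eta)] = p.@[sp eta].
Proof.
rewrite meval_subst; apply: meval_eq => i.
rewrite mevalZ mevalXU sp_Phi ord_predK ord_pred_eq_max mulrA -exprMn.
by rewrite mulVf // expr1n mul1r.
Qed.

Lemma msize_scaleX c (i : 'I_n.+1) :
  (msize (c *: 'X_i : {mpoly F[n.+1]}) <= 2)%N.
Proof. by apply: leq_trans (msizeZ_le _ _) _; rewrite msizeX mdeg1. Qed.

Lemma msize_shift p : (msize (shift p) <= msize p)%N.
Proof. by apply: msize_subst => i; apply: msize_scaleX. Qed.

Lemma msize_unshift p : (msize (unshift p) <= msize p)%N.
Proof. by apply: msize_subst => i; apply: msize_scaleX. Qed.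

End Positive.

Lemma mdeg_mnmwiden n (mu : 'X_{1..n}) : mdeg (mnmwiden mu) = mdeg mu.
Proof.
rewrite !mdegE big_ord_recr /= mnmwiden_ordmax addn0.
by apply: eq_bigr => i _; rewrite mnmwiden_widen.
Qed.

Lemma sp_mnmwiden_lo n (mu : 'X_{1..n}) (i : 'I_n) :
  sp (mnmwiden mu) (lo i) = sp mu i.
Proof.
rewrite /spectrum mnmwiden_widen (leg'_widen (mu := mu)) //.
  exact: mnmwiden_ordmax.
by move=> k; rewrite mnmwiden_widen.
Qed.

(** On the nodes with last part 0 the last variable takes the constant value
    t^(1-N), while the others run through the nodes in one variable less.  By
    induction on the number of variables, the polynomial is divisible by
    z_N - t^(1-N).  The other nodes are those of the compositions [Phi_comp mu],
    where that factor is nonzero, so that the quotient, after the substitution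
    [unshift], vanishes at the node of [mu]; induct on the degree. *)
Theorem vanishing_at_nodes n (p : {mpoly F[n]}) d : (msize p <= d)%N ->
  (forall mu : 'X_{1..n}, (mdeg mu < d)%N -> p.@[sp mu] = 0) -> p = 0.
Proof.
elim: n p d => [|n IHn] p d.
  case: d => [|d] hp hv; first by apply/eqP; rewrite -msize_poly_eq0 -leqn0.
  have := hv 0%MM; rewrite mdeg0 [p]nvar0_mpolyC mevalC => -> //.
elim: d p => [|d IHd] p hp hv; first by apply/eqP; rewrite -msize_poly_eq0 -leqn0.
(* The specialization of the last variable to its value at a final part 0. *)
pose c : F := t ^- n.
pose w (i : 'I_n.+1) : {mpoly F[n]} :=
  if unlift ord_max i is Some j then 'X_j else c%:MP.
have wlo j : w (lo j) = 'X_j.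
  have -> : lo j = lift ord_max j by apply: ord_inj; rewrite lift_max.
  by rewrite /w liftK.
have wmax : w ord_max = c%:MP by rewrite /w unlift_none.
have r0 : subst w p = 0.
  apply: (IHn _ d.+1) => [|mu hmu].
    apply: leq_trans hp; apply: msize_subst => i.
    have [[j ->]|->] := ord_lo_or_max i; first by rewrite wlo msizeX mdeg1.
    by rewrite wmax msizeC; case: (c != 0).
  rewrite meval_subst -(hv (mnmwiden mu)) ?mdeg_mnmwiden //.
  apply: meval_eq => i; have [[j ->]|->] := ord_lo_or_max i.
    by rewrite wlo mevalXU sp_mnmwiden_lo.
  by rewrite wmax mevalC sp_max0 // mnmwiden_ordmax.
have [h ph] : exists h, p = ('X_ord_max - c%:MP) * h.
  have [|h] := @subst_cong F n.+1 n.+1 (fun i => 'X_i)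
    (fun i => subst (fun j => 'X_(lo j)) (w i)) ('X_ord_max - c%:MP) p.
    move=> i; have [[j ->]|->] := ord_lo_or_max i.
      by exists 0; rewrite wlo substX subrr mulr0.
    by exists 1; rewrite wmax substC mulr1.
  rewrite -subst_subst r0 subst_id -mpolyC0 substC mpolyC0 subr0 => e.
  by exists h.
suff h0 : unshift h = 0.
  by rewrite ph -[h]unshiftK h0 /shift -mpolyC0 substC mpolyC0 mulr0.
apply: IHd => [|mu hmu].
  apply: leq_trans (msize_unshift _) _.
  by apply: msize_cofactor (msize_XsubC ord_max c) _; rewrite -ph.
rewrite meval_unshift; apply/eqP.
have hd : (mdeg (Phi_comp mu) < d.+1)%N by rewrite mdeg_Phi.
have /eqP := hv _ hd; rewrite ph mevalM mulf_eq0 mevalB mevalXU mevalC subr_eq0.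
by rewrite (negbTE (sp_max_neq (Phi_max mu))).
Qed.

End Spectrum.

(** * Divided differences and Hecke operators *)

Section DividedDifference.
Variables (F : fieldType) (n : nat) (a b : 'I_n).
Hypothesis ab : a != b.
Implicit Types p : {mpoly F[n]}.
Local Notation s := (msym (tperm a b)).

Lemma XsubX_neq0 : 'X_a - 'X_b != 0 :> {mpoly F[n]}.
Proof. by rewrite -msize_poly_eq0 msize_XsubX. Qed.

Lemma divdiff_unique p d : ('X_a - 'X_b) * d = s p - p -> divdiff a b p = d.
Proof. by rewrite -divdiffP => /(mulfI XsubX_neq0). Qed.

Lemma msymX1 (k : 'I_n) : s 'X_k = 'X_(tperm a b k) :> {mpoly F[n]}.
Proof. exact: (@substX F n n (fun i => 'X_(tperm a b i))). Qed.

Lemma msym_tpermK : involutive (s : {mpoly F[n]} -> {mpoly F[n]}).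
Proof. by move=> p; rewrite -msymMm tperm2 msym1m. Qed.

Lemma divdiffB p p' : divdiff a b (p - p') = divdiff a b p - divdiff a b p'.
Proof.
apply: divdiff_unique; rewrite mulrBr !divdiffP msymB.
by rewrite !opprD !opprK addrACA.
Qed.

Lemma divdiffZ c p : divdiff a b (c *: p) = c *: divdiff a b p.
Proof. by apply: divdiff_unique; rewrite -scalerAr divdiffP msymZ scalerBr. Qed.

Lemma divdiffM p p' :
  divdiff a b (p * p') = divdiff a b p * s p' + p * divdiff a b p'.
Proof.
apply: divdiff_unique; rewrite mulrDr mulrA divdiffP mulrCA divdiffP msymM.
by rewrite mulrBl mulrBr addrA subrK.
Qed.

Lemma msym_divdiff p : s (divdiff a b p) = divdiff a b p.
Proof.
apply: (mulfI XsubX_neq0).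
rewrite -[LHS]opprK -mulNr opprB -{1}(tpermR a b) -{1}(tpermL a b) -!msymX1.
by rewrite -msymB -msymM !divdiffP msymB msym_tpermK opprB.
Qed.

Lemma divdiff_divdiff p : divdiff a b (divdiff a b p) = 0.
Proof. by apply: divdiff_unique; rewrite mulr0 msym_divdiff subrr. Qed.

Lemma msize_divdiff p d : (msize p <= d.+1)%N -> (msize (divdiff a b p) <= d)%N.
Proof.
move=> hp; apply: msize_cofactor (msize_XsubX _ ab) _.
rewrite divdiffP; apply: msizeB_le (hp).
apply: leq_trans hp; apply: (@msize_subst F n n (fun i => 'X_(tperm a b i))) => i.
by rewrite msizeX mdeg1.
Qed.

End DividedDifference.

Section Hecke.

Variables (F : fieldType) (s : F) (n : nat).
Hypothesis s0 : s != 0.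
Implicit Types p : {mpoly F[n.+1]}.

Lemma opTB i p p' : opT s i (p - p') = opT s i p - opT s i p'.
Proof.
by rewrite /opT scalerBr divdiffB ?lo_neq_hi // mulrBr opprD addrACA.
Qed.

Lemma opTZ i c p : opT s i (c *: p) = c *: opT s i p.
Proof.
rewrite /opT divdiffZ ?lo_neq_hi // scalerDr -scalerAr; congr (_ + _).
by rewrite !scalerA mulrC.
Qed.

Lemma divdiff_opT i p :
  divdiff (lo i) (hi i) (opT s i p) = - divdiff (lo i) (hi i) p.
Proof.
have ne := lo_neq_hi i.
have DL : divdiff (lo i) (hi i) (s *: 'X_(lo i) - 'X_(hi i) : {mpoly F[n.+1]})
    = - (1 + s)%:MP.
  have lin (R : comNzRingType) (x y c : R) :
    (x - y) * - (1 + c) = c * y - x - (c * x - y) by ring.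
  apply: divdiff_unique => //; rewrite msymB msymZ !msymX1 tpermL tpermR.
  by rewrite mpolyCD mpolyC1 lin !mul_mpolyC.
have opTE : opT s i p = s *: p - (-1) *: ((s *: 'X_(lo i) - 'X_(hi i))
    * divdiff (lo i) (hi i) p) by rewrite scaleN1r opprK.
rewrite opTE divdiffB // !divdiffZ // divdiffM // divdiff_divdiff // mulr0.
rewrite addr0 msym_divdiff // DL mulNr scaleN1r opprK mul_mpolyC scalerDl.
by rewrite scale1r opprD addrCA subrr addr0.
Qed.

Lemma opT_quadratic i p : opT s i (opT s i p) = (s - 1) *: opT s i p + s *: p.
Proof.
rewrite {1}/opT divdiff_opT mulrN scalerBl scale1r -addrA; congr (_ + _).
by rewrite [opT s i p in RHS]/opT opprD addrAC addNr add0r.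
Qed.

Lemma opT_Xlo i p : opT s i ('X_(lo i) * p) = s *: ('X_(hi i) * opTinv s i p).
Proof.
have ne := lo_neq_hi i.
have DX : divdiff (lo i) (hi i) ('X_(lo i) : {mpoly F[n.+1]}) = -1.
  by apply: divdiff_unique => //; rewrite msymX1 tpermL mulrN1 opprB.
have sp : msym (tperm (lo i) (hi i)) p
    = p + ('X_(lo i) - 'X_(hi i)) * divdiff (lo i) (hi i) p.
  by rewrite divdiffP addrC subrK.
rewrite /opTinv /opT divdiffM // DX sp -!mul_mpolyC.
have sV : s%:MP * (s^-1)%:MP = 1 :> {mpoly F[n.+1]} by rewrite -mpolyCM divff.
rewrite mpolyCB mpolyC1.
have lin (R : comNzRingType) (x y c c' d f : R) : c * c' = 1 ->
  c * (x * f) + (c * x - y) * (-1 * (f + (x - y) * d) + x * d) =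
  c * (y * ((c' - 1) * f + c' * (c * f + (c * x - y) * d))).
  move=> e; have -> : c * (y * ((c' - 1) * f + c' * (c * f + (c * x - y) * d)))
   = (c * c') * (y * f + y * (c * f + (c * x - y) * d)) - c * y * f by ring.
  by rewrite e; ring.
exact: lin.
Qed.

(** At z_i = 0 the inverse Hecke operator is a multiple of a swap of variables. *)
Lemma opTinv_mod i p : exists d,
  opTinv s i p - s^-1 *: msym (tperm (lo i) (hi i)) p = 'X_(lo i) * d.
Proof.
have sp : msym (tperm (lo i) (hi i)) p
    = p + ('X_(lo i) - 'X_(hi i)) * divdiff (lo i) (hi i) p.
  by rewrite divdiffP addrC subrK.
exists ((1 - s^-1) *: divdiff (lo i) (hi i) p).
rewrite sp /opTinv /opT -!mul_mpolyC !mpolyCB !mpolyC1.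
have sV : s%:MP * (s^-1)%:MP = 1 :> {mpoly F[n.+1]} by rewrite -mpolyCM divff.
have lin (R : comNzRingType) (x y c c' d f : R) : c * c' = 1 ->
  (c' - 1) * f + c' * (c * f + (c * x - y) * d) - c' * (f + (x - y) * d)
  = x * ((1 - c') * d).
  move=> e; have -> : (c' - 1) * f + c' * (c * f + (c * x - y) * d)
     - c' * (f + (x - y) * d) = (c * c' - 1) * f + x * ((c * c' - c') * d) by ring.
  by rewrite e; ring.
exact: lin.
Qed.

Lemma msize_opT i p : (msize (opT s i p) <= msize p)%N.
Proof.
have [->|p0] := eqVneq p 0; first by rewrite -(scale0r 0) opTZ scale0r msize0.
apply: msizeDl_le; first exact: msizeZ_le.
rewrite (mpolySpred mdeg p0); apply: msizeMX_le.
  by apply: msizeB_le; rewrite ?msize_scaleX ?msizeX ?mdeg1.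
by apply: msize_divdiff; rewrite ?lo_neq_hi // -mpolySpred.
Qed.

Lemma msize_opTinv i p : (msize (opTinv s i p) <= msize p)%N.
Proof.
apply: msizeDl_le; first exact: msizeZ_le.
by apply: leq_trans (msizeZ_le _ _) (msize_opT _ _).
Qed.

Lemma opTinvE i p : opTinv s i p = (s^-1 - 1) *: p - (- s^-1) *: opT s i p.
Proof. by rewrite /opTinv scaleNr opprK. Qed.

Lemma opTinvK i p : opT s i (opTinv s i p) = p.
Proof.
rewrite opTinvE opTB !opTZ opT_quadratic -!mul_mpolyC !mpolyCN !mpolyCB mpolyC1.
have sV : s%:MP * (s^-1)%:MP = 1 :> {mpoly F[n.+1]} by rewrite -mpolyCM divff.
have lin (R : comNzRingType) (c c' g f : R) : c * c' = 1 ->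
  (c' - 1) * g - (- c') * ((c - 1) * g + c * f) = f.
  move=> e; have -> : (c' - 1) * g - (- c') * ((c - 1) * g + c * f)
    = (c * c' - 1) * g + (c * c') * f by ring.
  by rewrite e; ring.
exact: lin.
Qed.

End Hecke.

Section HeckeAtNodes.

Variables (F : fieldType) (q t : F).
Hypotheses (q0 : q != 0) (t0 : t != 0).
Hypothesis qt_indep : forall a b c d : nat,
  q ^+ a * t ^+ b = q ^+ c * t ^+ d -> a = c /\ b = d.
Variable n : nat.
Implicit Types (p : {mpoly F[n.+1]}) (eta mu nu : 'X_{1..n.+1}).

Local Notation sp := (spectrum q t).
Local Notation H := (opT t^-1).
Local Notation Hinv := (opTinv t^-1).

Lemma meval_msym i p eta : eta (lo i) != eta (hi i) ->
  (msym (tperm (lo i) (hi i)) p).@[sp eta] = p.@[sp (sw i eta)].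
Proof.
move=> ne; rewrite (@meval_subst F _ _ (fun k => 'X_(tperm (lo i) (hi i) k))).
by apply: meval_eq => k; rewrite mevalXU sp_sw.
Qed.

Lemma meval_divdiff i p eta : eta (lo i) != eta (hi i) ->
  (divdiff (lo i) (hi i) p).@[sp eta]
  = (p.@[sp (sw i eta)] - p.@[sp eta]) / (sp eta (lo i) - sp eta (hi i)).
Proof.
move=> ne; have d0 : sp eta (lo i) - sp eta (hi i) != 0.
  by rewrite subr_eq0 sp_lo_neq_hi.
apply: (mulfI d0); rewrite mulrCA divff // mulr1 -meval_msym // -mevalB.
by rewrite -divdiffP mevalM mevalB !mevalXU.
Qed.

(** If the two parts of [eta] agree then the swapped point is not a node.  In
    that case the coordinates at i and i + 1 have the ratio t, which kills the
    coefficient z_i / t - z_(i+1) of the divided difference in the operator with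
    parameter t^-1; this is why the interpolation polynomials for q and t go
    with the Hecke operators for the inverse parameters. *)
Lemma opT_vanish i p eta :
  p.@[sp eta] = 0 -> p.@[sp (sw i eta)] = 0 -> (H i p).@[sp eta] = 0.
Proof.
move=> e e'; rewrite /opT mevalD mevalZ e mulr0 add0r mevalM.
have [eq|ne] := eqVneq (eta (lo i)) (eta (hi i)).
  by rewrite mevalB mevalZ !mevalXU (sp_lo q t0 eq) mulKf // subrr mul0r.
by rewrite meval_divdiff // e e' subrr mul0r mulr0.
Qed.

Lemma opTinv_vanish i p eta :
  p.@[sp eta] = 0 -> p.@[sp (sw i eta)] = 0 -> (Hinv i p).@[sp eta] = 0.
Proof.
move=> e e'; rewrite /opTinv mevalD !mevalZ e mulr0 add0r.
by rewrite opT_vanish // mulr0.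
Qed.

Lemma opT_words s p eta :
    (forall nu, subword s eta nu -> p.@[sp nu] = 0) ->
  (foldr (@opT F t^-1 n) p s).@[sp eta] = 0.
Proof.
elim: s eta => [|i s IH] eta h /=; first exact: h.
by apply: opT_vanish; apply: IH => nu hnu; apply: h; [left | right].
Qed.

Lemma opTinv_words s p eta :
    (forall nu, subword s eta nu -> p.@[sp nu] = 0) ->
  (foldr (@opTinv F t^-1 n) p s).@[sp eta] = 0.
Proof.
elim: s eta => [|i s IH] eta h /=; first exact: h.
by apply: opTinv_vanish; apply: IH => nu hnu; apply: h; [left | right].
Qed.

Lemma meval_opT i p eta : eta (lo i) != eta (hi i) -> p.@[sp (sw i eta)] = 0 ->
  (H i p).@[sp eta]
  = (t^-1 - 1) / (1 - sp eta (lo i) / sp eta (hi i)) * p.@[sp eta].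
Proof.
move=> ne e; rewrite /opT mevalD mevalZ mevalM mevalB mevalZ !mevalXU.
rewrite meval_divdiff // e sub0r.
have d0 : sp eta (lo i) - sp eta (hi i) != 0 by rewrite subr_eq0 sp_lo_neq_hi.
have h0 := sp_neq0 q0 t0 eta (hi i).
have d1 : sp eta (hi i) - sp eta (lo i) != 0 by rewrite -opprB oppr_eq0.
by field; rewrite t0 h0 d0 d1.
Qed.

End HeckeAtNodes.

(** * The interpolation polynomials and their eigenvalue equation *)

Section Raising.
Variables (F : fieldType) (q t : F).
Hypotheses (q0 : q != 0) (t0 : t != 0).
Hypothesis qt_indep : forall a b c d : nat,
  q ^+ a * t ^+ b = q ^+ c * t ^+ d -> a = c /\ b = d.
Variable n : nat.
Implicit Types (p f g : {mpoly F[n.+1]}) (eta mu nu la ka : 'X_{1..n.+1}).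
Local Notation sp := (spectrum q t).

(** The inhomogeneous raising operator: its first factor vanishes at the nodes
    with last part 0, which are the ones that [shift] cannot pull back. *)
Definition Phi_raise p : {mpoly F[n.+1]} := ('X_ord_max - (t ^- n)%:MP) * shift q p.

Local Notation PhiOp := Phi_raise.

Lemma msize_PhiOp p d : (msize p <= d)%N -> (msize (PhiOp p) <= d.+1)%N.
Proof.
move=> h; apply: msizeMX_le; first by rewrite msize_XsubC.
exact: leq_trans (msize_shift _ _) h.
Qed.

Lemma PhiOpZ c p : PhiOp (c *: p) = c *: PhiOp p.
Proof. by rewrite /Phi_raise /shift substZ scalerAr. Qed.

Lemma PhiOpB p p' : PhiOp (p - p') = PhiOp p - PhiOp p'.
Proof. by rewrite /Phi_raise /shift substB mulrBr. Qed.

Lemma meval_PhiOp p eta : (PhiOp p).@[sp (Phi_comp eta)]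
  = (sp (Phi_comp eta) ord_max - t ^- n) * p.@[sp eta].
Proof. by rewrite mevalM mevalB mevalXU mevalC meval_shift. Qed.

Lemma PhiOp_Phi_eq0 p eta :
  (PhiOp p).@[sp (Phi_comp eta)] = 0 -> p.@[sp eta] = 0.
Proof.
move/eqP; rewrite meval_PhiOp mulf_eq0 subr_eq0.
by rewrite (negbTE (sp_max_neq t0 qt_indep (Phi_max eta))) => /eqP.
Qed.

Lemma PhiOp_vanish p nu :
    (forall mu, nu = Phi_comp mu -> p.@[sp mu] = 0) ->
  (PhiOp p).@[sp nu] = 0.
Proof.
move=> h; have [e|nz] := posnP (nu ord_max).
  by rewrite mevalM mevalB mevalXU mevalC sp_max0 // subrr mul0r.
by rewrite -(Phi_predK nz) meval_PhiOp h ?mulr0 // Phi_predK.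
Qed.

End Raising.

Section Interpolation.

Variables (F : fieldType) (q t : F).
Hypotheses (q0 : q != 0) (t0 : t != 0).
Hypothesis qt_indep : forall a b c d : nat,
  q ^+ a * t ^+ b = q ^+ c * t ^+ d -> a = c /\ b = d.
Variable n : nat.
Implicit Types (p f g : {mpoly F[n.+1]}) (eta mu nu la ka : 'X_{1..n.+1}).
Local Notation sp := (spectrum q t).
Local Notation PhiOp := (Phi_raise q t).

Variable Es : 'X_{1..n.+1} -> {mpoly F[n.+1]}.
Hypothesis EsP : forall eta, interpolation_Macdonald q t eta (Es eta).

Lemma msize_Es eta : (msize (Es eta) <= (mdeg eta).+1)%N.
Proof. by case: (EsP eta). Qed.

Lemma Es_vanish eta mu : mu != eta -> (mdeg mu <= mdeg eta)%N ->
  (Es eta).@[sp mu] = 0.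
Proof. by case: (EsP eta) => _ h _; apply: h. Qed.

Lemma Es_coef eta : (Es eta)@_eta = 1.
Proof. by case: (EsP eta). Qed.

(** Otherwise [Es eta] would vanish at all nodes up to its degree. *)
Lemma Es_node eta : (Es eta).@[sp eta] != 0.
Proof.
apply/eqP => e; have := oner_neq0 F; rewrite -(Es_coef eta).
rewrite (@vanishing_at_nodes F q t q0 t0 qt_indep _ _ _ (msize_Es eta)).
  by rewrite mcoeff0 eqxx.
by move=> mu hmu; have [->//|ne] := eqVneq mu eta; apply: Es_vanish.
Qed.

Lemma Es_unique eta f : (msize f <= (mdeg eta).+1)%N ->
    (forall mu, mu != eta -> (mdeg mu <= mdeg eta)%N -> f.@[sp mu] = 0) ->
  f = (f.@[sp eta] / (Es eta).@[sp eta]) *: Es eta.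
Proof.
move=> hf hv; apply/eqP; rewrite -subr_eq0; apply/eqP.
apply: (@vanishing_at_nodes F q t q0 t0 qt_indep _ _ (mdeg eta).+1).
  apply: msizeB_le => //.
  exact: leq_trans (msizeZ_le _ _) (msize_Es eta).
move=> mu hmu; rewrite mevalB mevalZ.
have [->|ne] := eqVneq mu eta; first by rewrite divfK ?subrr // Es_node.
by rewrite hv // (Es_vanish ne) // mulr0 subrr.
Qed.

Section Level.
Variables (d : nat) (c : 'X_{1..n.+1} -> F).
Let comb := \sum_(mu : 'X_{1..n.+1 < d.+1} | mdeg mu == d) c mu *: Es mu.

Lemma msize_level : (msize comb <= d.+1)%N.
Proof.
apply: leq_trans (msize_sum _ _ _) _; apply/bigmax_leqP_seq => mu _ /eqP e.
by apply: leq_trans (msizeZ_le _ _) _; have := msize_Es mu; rewrite e.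
Qed.

Lemma level_vanish nu : (mdeg nu < d)%N -> comb.@[sp nu] = 0.
Proof.
move=> lt; rewrite meval_sum big1 // => mu /eqP e; rewrite mevalZ.
rewrite (_ : (Es mu).@[sp nu] = 0) ?mulr0 //; apply: Es_vanish.
  by apply: contraTneq lt => ->; rewrite e ltnn.
by rewrite e ltnW.
Qed.

Lemma level_node nu : mdeg nu = d -> comb.@[sp nu] = c nu * (Es nu).@[sp nu].
Proof.
move=> e; have hnu : (mdeg nu < d.+1)%N by rewrite e.
rewrite meval_sum (bigD1 (BMultinom hnu)) ?e //= big1 => [|mu /andP[/eqP emu ne]].
  by rewrite addr0 mevalZ.
rewrite mevalZ (_ : (Es mu).@[sp nu] = 0) ?mulr0 //.
apply: Es_vanish; last by rewrite e emu.
by apply: contraNneq ne => h; apply/eqP/val_inj.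
Qed.

End Level.

(** Both sides take the same values at the nodes of modulus at most [d]: at those
    of modulus [d] the family [Es] is diagonal. *)
Lemma Es_expansion d f : (msize f <= d.+1)%N ->
    (forall mu, (mdeg mu < d)%N -> f.@[sp mu] = 0) ->
  f = \sum_(mu : 'X_{1..n.+1 < d.+1} | mdeg mu == d)
        (f.@[sp mu] / (Es mu).@[sp mu]) *: Es mu.
Proof.
move=> hf hv; apply/eqP; rewrite -subr_eq0; apply/eqP.
pose c nu := f.@[sp nu] / (Es nu).@[sp nu].
apply: (@vanishing_at_nodes F q t q0 t0 qt_indep _ _ d.+1).
  by apply: msizeB_le hf (msize_level _ c).
move=> nu; rewrite ltnS leq_eqVlt mevalB => /predU1P[e|lt].
  by rewrite (level_node c e) divfK ?subrr // Es_node.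
by rewrite hv // (level_vanish c lt) subrr.
Qed.

(** The left-hand side vanishes at all nodes of modulus at most |eta| + 1 other
    than that of [Phi_comp eta], as these pull back to nodes where [Es eta]
    vanishes. *)
Lemma PhiOp_Es eta : exists2 b, b != 0 & PhiOp (Es eta) = b *: Es (Phi_comp eta).
Proof.
have eq := @Es_unique (Phi_comp eta) (PhiOp (Es eta)).
eexists; last first.
  apply: eq; rewrite mdeg_Phi; first exact: msize_PhiOp (msize_Es _).
  move=> mu ne le; apply: PhiOp_vanish => // nu e; apply: Es_vanish.
    by apply: contraNneq ne => <-; rewrite e.
  by move: le; rewrite e mdeg_Phi.
rewrite mulf_neq0 ?invr_neq0 ?Es_node //.
by apply/eqP => /(PhiOp_Phi_eq0 q0 t0 qt_indep)/eqP; rewrite (negbTE (Es_node _)).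
Qed.

(** At z_1 = 0 the composite operator on the left is minus the identity.  Working
    outwards from the raising operator, which at z_N = 0 is -t^(1-N) times a
    cyclic permutation of the variables, each inverse Hecke operator contributes
    a factor t and a swap of variables, and the swaps undo the permutation. *)
Lemma Hinv_PhiOp_mod_X0 p : exists d,
  foldr (@opTinv F t^-1 n) (PhiOp p) (enum 'I_n) + p = 'X_ord0 * d.
Proof.
(* The cycles of variables that remain after the swaps behind k are undone. *)
pose h k (x : 'I_n.+1) : 'I_n.+1 :=
  if x == ord0 then inord k else if (x <= k)%N then ord_pred x else x.
pose R k := subst (fun x => 'X_(h k x)) p.
suff hyp m : (m <= n)%N -> exists d,
    foldr (@opTinv F t^-1 n) (PhiOp p) (drop (n - m) (enum 'I_n))
    - (- t ^- (n - m)) *: R (n - m)%N = 'X_(inord (n - m)) * d.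
  have [d] := hyp n (leqnn n); rewrite subnn drop0 expr0 invr1 scaleN1r opprK.
  have -> : R 0%N = p.
    rewrite /R -[RHS]subst_id; apply: eq_subst => x; rewrite /h leqn0.
    have i0 : inord 0 = ord0 :> 'I_n.+1 by apply: ord_inj; rewrite inordK.
    case: eqVneq => [->|ne]; first by rewrite i0.
    by rewrite (_ : (x : nat) == 0%N = (x == ord0)) // (negbTE ne).
  have -> : inord 0 = ord0 :> 'I_n.+1 by apply: ord_inj; rewrite inordK.
  by exists d.
elim: m => [_|m IH mn].
  rewrite subn0 drop_oversize ?size_enum_ord //=.
  have im : inord n = ord_max :> 'I_n.+1 by apply: ord_inj; rewrite inordK.
  have [i|d e] := @subst_cong F n.+1 n.+1
    (fun i => q^-1 ^+ (i == ord0) *: 'X_(ord_pred i)) (fun x => 'X_(h n x))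
    'X_ord_max p.
    rewrite /h; case: (eqVneq i ord0) => [->|ne].
      have -> : ord_pred ord0 = ord_max :> 'I_n.+1.
        by apply/eqP; rewrite ord_pred_eq_max.
      rewrite im expr1; exists (q^-1 - 1)%:MP.
      by rewrite [RHS]mulrC mul_mpolyC scalerBl scale1r.
    by exists 0; rewrite -ltnS ltn_ord expr0 scale1r subrr mulr0.
  rewrite -/(shift q p) -/(R n) in e.
  rewrite im; exists (shift q p - t ^- n *: d).
  rewrite mulrBr -scalerAr -e /Phi_raise mulrBl mul_mpolyC scaleNr opprK.
  by rewrite [in RHS]scalerBr opprB addrA addrAC.
have kn : (n - m.+1 < n)%N by lia.
have [d e] := IH (ltnW mn); pose k := Ordinal kn.
have Ek : (n - m)%N = k.+1 by rewrite /=; lia.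
rewrite Ek in e; rewrite -[(n - m.+1)%N]/(val k).
rewrite (drop_nth k) ?size_enum_ord // nth_ord_enum /=.
set G := foldr _ _ _ in e *.
have il : inord k = lo k by apply: ord_inj; rewrite /= inordK // ltnS ltnW.
have ih : inord k.+1 = hi k by apply: ord_inj; rewrite /= inordK // ltnS.
have [d1 e1] := opTinv_mod (invr_neq0 t0) k G.
rewrite invrK in e1; rewrite ih in e; rewrite -[(n - m.+1)%N]/(val k) il.
have RE : msym (tperm (lo k) (hi k)) (R k.+1) = R k.
  rewrite /R /msym -/(subst _ _) subst_subst; apply: eq_subst => x.
  have Hl : (lo k : nat) = k by [].
  have Hh : (hi k : nat) = k.+1 by rewrite /= /bump.
  rewrite substX /h; case: (eqVneq x ord0) => [_|x0]; first by rewrite il ih tpermR.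
  have vx : (x : nat) = (ord_pred x).+1.
    by have := val_ordS (ord_pred x); rewrite ord_predK ord_pred_eq_max (negbTE x0).
  have ne (y z : 'I_n.+1) : (y : nat) <> z -> y != z.
    by move=> yz; apply/eqP => eyz; apply: yz; rewrite eyz.
  have [xk|xk|xk] := ltngtP x k.+1.
  - by rewrite -ltnS xk tpermD //; apply: ne; rewrite ?Hl ?Hh; lia.
  - by rewrite (leqNgt x k) (ltnW xk) tpermD //; apply: ne; rewrite ?Hl ?Hh; lia.
  - rewrite xk ltnn (_ : ord_pred x = lo k); last by apply: ord_inj; lia.
    by rewrite tpermL; congr 'X_ _; apply: ord_inj; rewrite Hh.
have GE : G = (- t ^- k.+1) *: R k.+1 + 'X_(hi k) * d by rewrite -e addrC subrK.
have msG : msym (tperm (lo k) (hi k)) G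
    = (- t ^- k.+1) *: R k + 'X_(lo k) * msym (tperm (lo k) (hi k)) d.
  by rewrite [in LHS]GE msymD msymZ RE msymM msymX1 tpermR.
have tk : t * - t ^- k.+1 = - t ^- k.
  by rewrite mulrN exprS invfM mulrA divff // mul1r.
exists (d1 + t *: msym (tperm (lo k) (hi k)) d).
by rewrite mulrDr -e1 msG scalerDr opprD addrA scalerA tk -scalerAr subrK.
Qed.

(** The left-hand side plus [Es eta] is divisible by z_1.  The quotient has degree
    at most |eta| and vanishes at the nodes of modulus at most |eta| other than
    that of [eta], so it is a multiple of [Es eta]; evaluation at [eta] gives the
    factor. *)
Lemma eigenvalue_equation eta :
  foldr (@opTinv F t^-1 n) (PhiOp (Es eta)) (enum 'I_n)
  = (sp eta ord0)^-1 *: ('X_ord0 * Es eta) - Es eta.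
Proof.
have [d e] := Hinv_PhiOp_mod_X0 (Es eta).
set G := foldr _ _ _ in e *.
have X2 : msize ('X_ord0 : {mpoly F[n.+1]}) = 2 by rewrite msizeX mdeg1.
have szG : (msize G <= (mdeg eta).+2)%N.
  rewrite /G; elim: (enum 'I_n) => [|i s IH] /=; first exact: msize_PhiOp (msize_Es _).
  exact: leq_trans (msize_opTinv _ _ _) IH.
have vG mu : (mdeg mu <= mdeg eta)%N -> G.@[sp mu] = 0.
  move=> hmu; apply: opTinv_words => // nu /mdeg_subword hnu.
  apply: PhiOp_vanish => // ka eka.
  have hk : (mdeg ka < mdeg eta)%N by rewrite -mdeg_Phi -eka hnu.
  by apply: Es_vanish (ltnW hk); apply: contraTneq hk => ->; rewrite ltnn.
have ed : d = (d.@[sp eta] / (Es eta).@[sp eta]) *: Es eta.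
  apply: Es_unique => [|mu ne le].
    apply: msize_cofactor X2 _; rewrite -e; apply: msizeDl_le szG _.
    exact: leq_trans (msize_Es _) (leqnSn _).
  apply/eqP; rewrite -(mulrI_eq0 _ (mulfI (sp_neq0 q0 t0 mu ord0))).
  by rewrite -mevalXU -mevalM -e mevalD vG // (Es_vanish ne) // addr0.
have ea : d.@[sp eta] / (Es eta).@[sp eta] = (sp eta ord0)^-1.
  apply: (mulfI (sp_neq0 q0 t0 eta ord0)); rewrite divff ?sp_neq0 // mulrA.
  by rewrite -mevalXU -mevalM -e mevalD vG // add0r divff // Es_node.
by rewrite -[LHS](addrK (Es eta)) e {1}ed ea -scalerAr.
Qed.

(** * Extra vanishing *)

(** For the first variable this is read off the eigenvalue equation, since the
    words of swaps from [Phi_comp eta] end in successors of [eta].  The raising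
    operator turns the statement for the i-th variable at [Phi_comp eta] into the
    statement for the next variable at [eta]. *)
Lemma Es_vanish_next i eta mu : mdeg mu = (mdeg eta).+1 -> ~~ succ' eta mu ->
  (('X_i - (sp eta i)%:MP) * Es eta).@[sp mu] = 0.
Proof.
have [j ->] : exists j : 'I_n.+1, i = inord j by exists i; rewrite inord_val.
case: j => j /=; elim: j eta mu => [|j IH] eta mu jn; last first.
  pose k : 'I_n := Ordinal (jn : (j < n)%N).
  have il : inord j = lo k by apply: ord_inj; rewrite /= inordK // ltnW.
  have -> : inord j.+1 = hi k by apply: ord_inj; rewrite /= inordK.
  move=> hmu ns; have spk nu : sp nu (hi k) = sp (Phi_comp nu) (lo k).
    by rewrite sp_Phi ordS_lo -val_eqE /= ltn_eqF ?mul1r.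
  have := IH (Phi_comp eta) (Phi_comp mu) (ltnW jn).
  rewrite !mdeg_Phi hmu succ_Phi ns => /(_ erefl isT)/eqP.
  rewrite il !mevalM !mevalB !mevalXU !mevalC !spk mulf_eq0 => /orP[/eqP ->|].
    by rewrite mul0r.
  have [b b0 e] := PhiOp_Es eta; rewrite -(mulrI_eq0 _ (mulfI b0)) -mevalZ -e.
  by move=> /eqP /(PhiOp_Phi_eq0 q0 t0 qt_indep) ->; rewrite mulr0.
move=> hmu ns.
have -> : inord 0 = ord0 :> 'I_n.+1 by apply: ord_inj; rewrite inordK.
have e := congr1 (meval (sp mu)) (eigenvalue_equation eta).
have G0 : (foldr (@opTinv F t^-1 n) (PhiOp (Es eta)) (enum 'I_n)).@[sp mu] = 0.
  apply: opTinv_words => // nu hnu; have [b _ ->] := PhiOp_Es eta.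
  rewrite mevalZ (_ : (Es _).@[_] = 0) ?mulr0 //; apply: Es_vanish; last first.
    by rewrite (mdeg_subword hnu) mdeg_Phi hmu.
  apply: contraNneq ns => enu; rewrite enu in hnu.
  exact: succ_subword_Phi (subword_rev hnu).
rewrite mevalM mevalB mevalXU mevalC; move: e.
rewrite G0 mevalB mevalZ mevalM mevalXU => /esym/eqP.
rewrite subr_eq0 => /eqP e; rewrite mulrBl -{2}e mulrA divff ?sp_neq0 //.
by rewrite mul1r subrr.
Qed.

(** If [mu] is not [eta], some coordinate of their nodes differs.  For this i,
    the expansion of (z_i - eta_i) E*_eta involves only successors [nu] of [eta]
    of the next modulus, and by induction those with E*_nu nonzero at [mu]
    precede [mu]. *)
Theorem extra_vanishing eta mu : ~~ succ' eta mu -> (Es eta).@[sp mu] = 0.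
Proof.
elim: (mdeg mu - mdeg eta)%N {-2}eta (leqnn (mdeg mu - mdeg eta)) => [|m IH] {}eta.
  rewrite leqn0 subn_eq0 => le ns; apply: Es_vanish => //.
  by apply: contraNneq ns => ->; apply: succ_refl.
move=> le ns; have ne : mu != eta by apply: contraNneq ns => ->; apply: succ_refl.
have [i hi] := sp_separates t0 qt_indep ne.
set f := ('X_i - (sp eta i)%:MP) * Es eta.
have fE : f = \sum_(nu : 'X_{1..n.+1 < (mdeg eta).+2} | mdeg nu == (mdeg eta).+1)
        (f.@[sp nu] / (Es nu).@[sp nu]) *: Es nu.
  apply: Es_expansion => [|nu hnu].
    by apply: msizeMX_le (msize_Es _); rewrite msize_XsubC.
  rewrite /f mevalM mevalB mevalXU mevalC.
  have [->|nn] := eqVneq nu eta; first by rewrite subrr mul0r.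
  by rewrite (Es_vanish nn) // mulr0.
have : f.@[sp mu] = 0.
  rewrite fE meval_sum big1 // => nu /eqP hnu; rewrite mevalZ.
  have [sn|nsn] := boolP (succ' eta nu); last first.
    by rewrite [f.@[_]]Es_vanish_next // !mul0r.
  rewrite IH ?mulr0 //; first by rewrite hnu; lia.
  by apply: contra ns; apply: succ_trans.
rewrite /f mevalM mevalB mevalXU mevalC => /eqP.
by rewrite mulf_eq0 subr_eq0 (negbTE hi) => /eqP.
Qed.

End Interpolation.

(** * Supports of top components *)

Lemma subr_morph_sum (V W : zmodType) (f : V -> W) :
    {morph f : x y / x - y} -> forall I (r : seq I) (P : pred I) (G : I -> V),
  f (\sum_(i <- r | P i) G i) = \sum_(i <- r | P i) f (G i).
Proof.
move=> fB I r P G; have f0 : f 0 = 0 by rewrite -[0]subr0 fB subrr.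
have fN x : f (- x) = - f x by rewrite -sub0r fB f0 sub0r.
apply: (big_morph f _ f0) => x y.
by rewrite -[y in LHS]opprK fB fN opprK.
Qed.

Section Descent.

Variables (F : fieldType) (s : F) (n : nat).
Hypothesis s0 : s != 0.
Implicit Types p : {mpoly F[n.+1]}.

(** The product T_(N-1) ... T_1, which inverts the product of inverse Hecke
    operators in the eigenvalue equation. *)
Definition descend p := foldr (@opT F s n) p (rev (enum 'I_n)).

Lemma descendB : {morph descend : p p' / p - p'}.
Proof.
by rewrite /descend => p p'; elim: (rev _) => [|i r IH] //=; rewrite IH opTB.
Qed.

Lemma descendZ c p : descend (c *: p) = c *: descend p.
Proof. by rewrite /descend; elim: (rev _) => [|i r IH] //=; rewrite IH opTZ. Qed.

Lemma msize_descend p : (msize (descend p) <= msize p)%N.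
Proof.
rewrite /descend; elim: (rev _) => [|i r IH] //=.
exact: leq_trans (msize_opT _ _ _) IH.
Qed.

Lemma descendK p : descend (foldr (@opTinv F s n) p (enum 'I_n)) = p.
Proof.
rewrite /descend; elim: (enum 'I_n) => [|i r IH] //=.
by rewrite rev_cons foldr_rcons opTinvK.
Qed.

(** By the relation T_i z_i = s z_(i+1) T_i^-1, moving T_(N-1) ... T_1 past z_1
    produces z_N and replaces each operator by its inverse. *)
Lemma descend_X0 p : descend ('X_ord0 * p) = s ^+ n *: Phiq s p.
Proof.
rewrite /descend /Phiq -foldl_rev revK.
have -> : 'X_ord_max = 'X_(inord n) :> {mpoly F[n.+1]}.
  by congr 'X_ _; apply: ord_inj; rewrite inordK.
have -> : 'X_ord0 = 'X_(inord 0) :> {mpoly F[n.+1]}.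
  by congr 'X_ _; apply: ord_inj; rewrite inordK.
suff main k : (k <= n)%N ->
    foldl (fun z i => opT s i z) ('X_(inord 0) * p) (take k (enum 'I_n))
    = s ^+ k *: ('X_(inord k) *
        foldl (fun z i => opTinv s i z) p (take k (enum 'I_n))).
  have := main n (leqnn n).
  by rewrite take_oversize ?size_enum_ord.
elim: k => [|k IH] kn; first by rewrite take0 expr0 scale1r.
pose i := Ordinal kn.
have il : inord k = lo i by apply: ord_inj; rewrite /= inordK // ltnS ltnW.
have ih : inord k.+1 = hi i by apply: ord_inj; rewrite /= inordK.
rewrite (take_nth i) ?size_enum_ord // !foldl_rcons (IH (ltnW kn)).
have -> : nth i (enum 'I_n) k = i by rewrite -[k]/(val i) nth_ord_enum.
by rewrite opTZ il opT_Xlo // scalerA -exprSr ih.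
Qed.

End Descent.

Section Support.

Variables (F : fieldType) (q t : F).
Hypotheses (q0 : q != 0) (t0 : t != 0).
Hypothesis qt_indep : forall a b c d : nat,
  q ^+ a * t ^+ b = q ^+ c * t ^+ d -> a = c /\ b = d.
Variable n : nat.
Implicit Types (p f g : {mpoly F[n.+1]}) (eta mu nu la ka : 'X_{1..n.+1}).
Local Notation sp := (spectrum q t).
Local Notation PhiOp := (Phi_raise q t).
Local Notation descendV := (@descend F t^-1 n).

Variable Es : 'X_{1..n.+1} -> {mpoly F[n.+1]}.
Hypothesis EsP : forall eta, interpolation_Macdonald q t eta (Es eta).

Let uniq0 := @vanishing_at_nodes F q t q0 t0 qt_indep n.+1.

Lemma PhiOp_eigen eta :
  PhiOp (Es eta) = descendV ((sp eta ord0)^-1 *: ('X_ord0 * Es eta) - Es eta).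
Proof. by rewrite -(eigenvalue_equation q0 t0 qt_indep EsP) descendK ?invr_neq0. Qed.

(** Every polynomial [f] of degree at most [d] has exactly one such [g].  The
    values of [g] at the nodes of modulus [d] are, up to nonzero factors, the
    coordinates of the part of degree [d] of [f] in the basis formed by the top
    components of the polynomials [Es mu].  Supports in this basis are thus
    statements about zeros at nodes. *)
Definition node_lift d f g : Prop :=
  [/\ (msize g <= d.+1)%N, (msize (g - f) <= d)%N &
      forall mu, (mdeg mu < d)%N -> g.@[sp mu] = 0].

Lemma lift_unique d f g g' : node_lift d f g -> node_lift d f g' -> g = g'.
Proof.
move=> [_ h v] [_ h' v']; apply/eqP; rewrite -subr_eq0; apply/eqP.
apply: (uniq0 (d := d)) => [|mu hmu]; last by rewrite mevalB v // v' // subrr.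
have -> : g - g' = (g - f) - (g' - f) by rewrite opprB addrA subrK.
exact: msizeB_le.
Qed.

(** Values are adjusted one modulus at a time, as the polynomials [Es mu] of a
    given modulus do not disturb the smaller nodes. *)
Lemma interpolate d (v : 'X_{1..n.+1} -> F) : exists2 h : {mpoly F[n.+1]},
  (msize h <= d)%N & forall mu, (mdeg mu < d)%N -> h.@[sp mu] = v mu.
Proof.
elim: d => [|d [h hs hv]]; first by exists 0; rewrite ?msize0.
pose c nu := (v nu - h.@[sp nu]) / (Es nu).@[sp nu].
exists (h + \sum_(mu : 'X_{1..n.+1 < d.+1} | mdeg mu == d) c mu *: Es mu).
  by apply: msizeDl_le (leq_trans hs _) (msize_level EsP d c).
move=> mu; rewrite ltnS leq_eqVlt mevalD => /predU1P[e|lt].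
  rewrite (level_node EsP c e) divfK; first by rewrite addrC subrK.
  exact: (Es_node q0 t0 qt_indep EsP mu).
by rewrite (level_vanish EsP c lt) addr0 hv.
Qed.

Lemma lift_exists d f : (msize f <= d.+1)%N -> exists g, node_lift d f g.
Proof.
move=> hf; have [h hs hv] := interpolate d (fun mu => f.@[sp mu]).
exists (f - h); split.
- exact: msizeB_le hf (leq_trans hs _).
- by rewrite addrAC subrr sub0r msizeN.
- by move=> mu /hv e; rewrite mevalB e subrr.
Qed.

(** The raising operator on lifts induces its homogeneous version
    f |-> z_N f(z_N / q, z_1, ..., z_(N-1)) on top parts. *)
Lemma lift_PhiOp d f g : (msize f <= d.+1)%N -> node_lift d f g ->
  node_lift d.+1 ('X_ord_max * shift q f) (PhiOp g).
Proof.
move=> hf [h1 h2 h3]; split; first exact: msize_PhiOp.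
- have -> : PhiOp g - 'X_ord_max * shift q f
    = 'X_ord_max * shift q (g - f) - (t ^- n)%:MP * shift q g.
    by rewrite /Phi_raise /shift substB mulrBl mulrBr; apply: addrAC.
  apply: msizeB_le; first apply: msizeMX_le.
  + by rewrite msizeX mdeg1.
  + exact: leq_trans (msize_shift _ _) h2.
  + rewrite mul_mpolyC; apply: leq_trans (msizeZ_le _ _) _.
    exact: leq_trans (msize_shift _ _) h1.
- move=> mu hmu; apply: PhiOp_vanish => // nu e; apply: h3.
  by move: hmu; rewrite e mdeg_Phi.
Qed.

(** The part of degree [d] of [f] lies in the span of the top components of the
    polynomials [Es la] for [la] preceding [ka]. *)
Definition below ka d f : Prop := exists2 g, node_lift d f g &
  forall mu, mdeg mu = d -> ~~ succ' mu ka -> g.@[sp mu] = 0.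

(** Let [k] lift [f].  By the eigenvalue equations, the Hecke operators
    T_(N-1) ... T_1 map the lift of z_1 f to the image under the raising operator
    of a combination of the [Es mu] whose coefficients are nonzero multiples of
    those of [k].  So if [k] does not vanish at [la], then the lift of z_1 f is
    nonzero at some node reached from [Phi_comp la] by a subword of swaps, whose
    composition is a successor of [la] and precedes [ka]. *)
Lemma below_div_X0 ka d f : (msize f <= d.+1)%N ->
  below ka d.+1 ('X_ord0 * f) -> below ka d f.
Proof.
move=> hf [g [hg1 hg2 hg3] hg4]; have [k hk] := lift_exists hf.
have [hk1 hk2 hk3] := hk; exists k => // la hla ns.
have X2 : (msize ('X_ord0 : {mpoly F[n.+1]}) <= 2)%N by rewrite msizeX mdeg1.
pose c mu := sp mu ord0 * (k.@[sp mu] / (Es mu).@[sp mu]).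
pose W := \sum_(mu : 'X_{1..n.+1 < d.+1} | mdeg mu == d) c mu *: Es mu.
have hW : (msize W <= d.+1)%N := msize_level EsP d c.
have opW : descendV ('X_ord0 * k - W) = PhiOp W.
  rewrite {1}(Es_expansion q0 t0 qt_indep EsP hk1 hk3) /W mulr_sumr -sumrB.
  rewrite (subr_morph_sum (@descendB F t^-1 n)) (subr_morph_sum (@PhiOpB _ q t n)).
  apply: eq_bigr => mu _; rewrite PhiOpZ PhiOp_eigen -descendZ; congr descendV.
  rewrite scalerBr scalerA -scalerAr; congr (_ *: _ - _).
  by rewrite /c mulrAC divff ?mul1r // sp_neq0.
have KW : descendV g = PhiOp W.
  apply/eqP; rewrite -subr_eq0; apply/eqP; apply: (uniq0 (d := d.+1)).
    rewrite -opW -descendB; apply: leq_trans (msize_descend _ _) _.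
    have -> : g - ('X_ord0 * k - W)
      = (g - 'X_ord0 * f) - ('X_ord0 * (k - f) - W).
      by rewrite mulrBr [_ - _ - W]addrAC [in RHS]opprB addrA subrK.
    apply: msizeB_le => //; apply: msizeB_le => //; exact: msizeMX_le.
  move=> nu hnu; rewrite mevalB [X in X - _]opT_words // => [|mu /mdeg_subword e].
    rewrite PhiOp_vanish ?subrr // => mu e; apply: (level_vanish EsP c).
    by move: hnu; rewrite e mdeg_Phi.
  by apply: hg3; rewrite e.
have : (descendV g).@[sp (Phi_comp la)] = 0.
  apply: opT_words => // nu hnu; apply: hg4.
    by rewrite (mdeg_subword hnu) mdeg_Phi hla.
  by apply: contra ns; apply: succ_trans (succ_subword_Phi hnu).
rewrite KW => /(PhiOp_Phi_eq0 q0 t0 qt_indep)/eqP.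
rewrite /W (level_node EsP c hla) /c -mulrA divfK; last first.
  exact: (Es_node q0 t0 qt_indep EsP la).
by rewrite mulf_eq0 (negbTE (sp_neq0 q0 t0 la ord0)) => /eqP.
Qed.

Lemma shift_X (i : 'I_n) f :
  'X_ord_max * shift q ('X_(hi i) * f) = 'X_(lo i) * ('X_ord_max * shift q f).
Proof.
rewrite /shift substM substX (_ : (hi i == ord0) = false) // expr0 scale1r.
by rewrite -ordS_lo ordSK mulrCA.
Qed.

(** The raising operator conjugates multiplication by z_(i+1) into
    multiplication by z_i, which reduces every variable to the first one. *)
Lemma below_div_X i ka d f : (msize f <= d.+1)%N ->
  below ka d.+1 ('X_i * f) -> below ka d f.
Proof.
have [j ->] : exists j : 'I_n.+1, i = inord j by exists i; rewrite inord_val.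
case: j => j /=; elim: j ka d f => [|j IH] ka d f jn hf.
  have -> : inord 0 = ord0 :> 'I_n.+1 by apply: ord_inj; rewrite inordK.
  exact: below_div_X0.
pose k : 'I_n := Ordinal (jn : (j < n)%N).
have il : inord j = lo k by apply: ord_inj; rewrite /= inordK // ltnW.
have -> : inord j.+1 = hi k by apply: ord_inj; rewrite /= inordK.
have X2 l : (msize ('X_l : {mpoly F[n.+1]}) <= 2)%N by rewrite msizeX mdeg1.
move=> [g hg hg4]; have [h hh] := lift_exists hf; exists h => // la hla ns.
have hf' : (msize ('X_ord_max * shift q f) <= d.+2)%N.
  by apply: msizeMX_le => //; apply: leq_trans (msize_shift _ _) hf.
have [|h' hh' hv'] := IH (Phi_comp ka) d.+1 _ (ltnW jn) hf'.
  exists (PhiOp g).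
    by rewrite il -shift_X; apply: lift_PhiOp => //; apply: msizeMX_le.
  move=> mu hmu nmu; apply: PhiOp_vanish => // nu e; apply: hg4.
    by move: hmu; rewrite e mdeg_Phi => -[].
  by move: nmu; rewrite e succ_Phi.
apply: (PhiOp_Phi_eq0 q0 t0 qt_indep).
rewrite -(lift_unique hh' (lift_PhiOp hf hh)); apply: hv'.
  by rewrite mdeg_Phi hla.
by rewrite succ_Phi.
Qed.

Lemma msize_prodX (r : seq 'I_n.+1) p d :
  (msize p <= d)%N -> (msize ((\prod_(i <- r) 'X_i) * p) <= size r + d)%N.
Proof.
move=> h; elim: r => [|i r IH]; first by rewrite big_nil mul1r.
by rewrite big_cons -mulrA; apply: msizeMX_le; rewrite ?msizeX ?mdeg1.
Qed.

Lemma below_div_prodX r ka d f : (msize f <= d.+1)%N ->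
  below ka (size r + d) ((\prod_(i <- r) 'X_i) * f) -> below ka d f.
Proof.
move=> hf; elim: r => [|i r IH]; first by rewrite big_nil mul1r.
rewrite big_cons -mulrA => h; apply: IH; apply: below_div_X h.
by rewrite -addnS; apply: msize_prodX.
Qed.

Lemma below_sum ka d I (r : seq I) (P : pred I) (G : I -> {mpoly F[n.+1]}) :
  (forall i, P i -> below ka d (G i)) -> below ka d (\sum_(i <- r | P i) G i).
Proof.
move=> h; elim/big_ind: _ => //.
  by exists 0; [split; rewrite ?subr0 ?msize0 // => mu _ | move=> mu _ _]; rewrite meval0.
move=> x y [g [h1 h2 h3] h4] [g' [h1' h2' h3'] h4']; exists (g + g').
  split; first exact: msizeDl_le.
    by rewrite opprD addrACA; apply: msizeDl_le.
  by move=> mu hmu; rewrite mevalD h3 // h3' // addr0.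
by move=> mu hmu ns; rewrite mevalD h4 // h4' // addr0.
Qed.

Lemma belowZ ka d c f : below ka d f -> below ka d (c *: f).
Proof.
move=> [g [h1 h2 h3] h4]; exists (c *: g).
  split; first exact: leq_trans (msizeZ_le _ _) h1.
    by rewrite -scalerBr; apply: leq_trans (msizeZ_le _ _) h2.
  by move=> mu hmu; rewrite mevalZ h3 // mulr0.
by move=> mu hmu ns; rewrite mevalZ h4 // mulr0.
Qed.

End Support.

(** * Top components of the interpolation polynomials *)

Section Pieri.

Variables (F : fieldType) (q t : F).
Hypotheses (q0 : q != 0) (t0 : t != 0).
Hypothesis qt_indep : forall a b c d : nat,
  q ^+ a * t ^+ b = q ^+ c * t ^+ d -> a = c /\ b = d.
Variable n : nat.
Implicit Types (p f g : {mpoly F[n.+1]}) (eta mu nu la ka : 'X_{1..n.+1}).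
Local Notation sp := (spectrum q t).
Local Notation descendV := (@descend F t^-1 n).

Variables Es Et : 'X_{1..n.+1} -> {mpoly F[n.+1]}.
Hypothesis EsP : forall eta, interpolation_Macdonald q t eta (Es eta).
Hypothesis EtP : nonsymmetric_Macdonald q^-1 t^-1 Et.

Lemma spectrumV eta i : spectrum q^-1 t^-1 eta i = (sp eta i)^-1.
Proof. by rewrite /spectrum invfM !exprVn. Qed.

Lemma dhomog_small p d : p \is d.-homog -> (msize p <= d)%N -> p = 0.
Proof.
move=> hp /msize_leP hs; apply/mpolyP => m; rewrite mcoeff0.
have [e|ne] := eqVneq (mdeg m) d; first by apply: hs; rewrite e.
exact: dhomog_nemf_coeff hp ne.
Qed.

Lemma msize_dhomog p d : p \is d.-homog -> (msize p <= d.+1)%N.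
Proof.
move=> hp; apply/msize_leP => m hm; apply: (dhomog_nemf_coeff hp).
by rewrite neq_ltn hm orbT.
Qed.

Lemma Et_homog eta : Et eta \is (mdeg eta).-homog.
Proof. by case: EtP => h _ _ _; case: (h eta). Qed.

Lemma Et_coef eta : (Et eta)@_eta = 1.
Proof. by case: EtP => h _ _ _; case: (h eta). Qed.

Lemma msize_Et eta : (msize (Et eta) <= (mdeg eta).+1)%N.
Proof. exact/msize_dhomog/Et_homog. Qed.

(** Comparing the coefficients of z^eta gives b = c. *)
Lemma top_normalized eta b c p p' : c != 0 -> p@_eta = 1 -> p'@_eta = 1 ->
  (msize (b *: p - c *: p') <= mdeg eta)%N -> (msize (p - p') <= mdeg eta)%N.
Proof.
move=> c0 e e' h; have := msize_leP _ _ h eta (leqnn _).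
rewrite mcoeffB !mcoeffZ e e' !mulr1 => /eqP; rewrite subr_eq0 => /eqP bc.
by move: h; rewrite bc -scalerBr msizeZ.
Qed.

(** Applying T_(N-1) ... T_1 to the eigenvalue equation shows that the multiple
    of E*_(Phi eta) given by the raising operator has the same top part as
    T_(N-1) ... T_1 z_1 E*_eta / eta_1, and this is a multiple of Phi_q E*_eta. *)
Lemma top_Phi eta : (msize (Es eta - Et eta) <= mdeg eta)%N ->
  (msize (Es (Phi_comp eta) - Et (Phi_comp eta)) <= (mdeg eta).+1)%N.
Proof.
move=> h; rewrite -mdeg_Phi.
have [b b0 eb] := PhiOp_Es q0 t0 qt_indep EsP eta.
have [_ _ hPhi _] := EtP.
pose a := (sp eta ord0)^-1.
pose c := t^-1 ^- #|[set i : 'I_n.+1 | (0 < i)%N && (eta i <= eta ord0)%N]|.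
have ec : descendV (a *: ('X_ord0 * Et eta)) = (a * t^-1 ^+ n * c) *: Et (Phi_comp eta).
  by rewrite descendZ descend_X0 ?invr_neq0 // hPhi !scalerA.
apply: (@top_normalized _ b (a * t^-1 ^+ n * c)).
- by rewrite !mulf_neq0 ?invr_neq0 ?expf_neq0 ?invr_neq0 ?sp_neq0.
- exact: Es_coef.
- exact: Et_coef.
rewrite -eb -ec (PhiOp_eigen q0 t0 qt_indep EsP) -descendB.
apply: leq_trans (msize_descend _ _) _; rewrite mdeg_Phi addrAC -scalerBr -mulrBr.
apply: msizeB_le; last exact: (msize_Es EsP).
apply: leq_trans (msizeZ_le _ _) _; apply: msizeMX_le h.
by rewrite msizeX mdeg1.
Qed.

(** By interpolation T_i E*_eta is a combination of E*_eta and E*_(s_i eta).  Its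
    first coefficient, found by evaluation at [eta], is the one in the recursion
    for the nonsymmetric polynomials; the second one is forced by the
    normalization. *)
Lemma top_sw (i : 'I_n) eta : (eta (lo i) < eta (hi i))%N ->
    (msize (Es eta - Et eta) <= mdeg eta)%N ->
  (msize (Es (sw i eta) - Et (sw i eta)) <= mdeg eta)%N.
Proof.
move=> lt h; have ne : eta (lo i) != eta (hi i) by rewrite neq_ltn lt.
have ns : sw i eta != eta.
  by apply: contraNneq ne => e; rewrite -{1}e sw_lo.
have [_ _ _ hT] := EtP; have := hT eta i lt; rewrite !spectrumV /=.
rewrite invfM !invrK; set c1 := (t^-1 - 1) / _ => {}hT.
pose f := opT t^-1 i (Es eta) - c1 *: Es eta.
have vsw : (Es eta).@[sp (sw i eta)] = 0 by apply: (Es_vanish EsP); rewrite ?mdeg_sw.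
have [c2 ef] : exists c2, f = c2 *: Es (sw i eta).
  eexists; apply: (Es_unique q0 t0 qt_indep EsP); rewrite mdeg_sw.
    apply: msizeB_le; first exact: leq_trans (msize_opT _ _ _) (msize_Es EsP _).
    exact: leq_trans (msizeZ_le _ _) (msize_Es EsP _).
  move=> mu nmu le; rewrite mevalB mevalZ.
  have [->|nm] := eqVneq mu eta.
    by rewrite (meval_opT q0 t0 qt_indep) // subrr.
  rewrite (Es_vanish EsP nm le) mulr0 subr0 opT_vanish //.
    exact: (Es_vanish EsP).
  apply: (Es_vanish EsP); rewrite ?mdeg_sw //.
  by apply: contraNneq nmu => e; rewrite -e swK.
rewrite -(mdeg_sw i); apply: (@top_normalized _ c2 t^-1).
- exact: invr_neq0.
- exact: Es_coef.
- exact: Et_coef.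
have et : t^-1 *: Et (sw i eta) = opT t^-1 i (Et eta) - c1 *: Et eta.
  by rewrite hT addrAC subrr add0r.
rewrite -ef et /f mdeg_sw.
have -> : opT t^-1 i (Es eta) - c1 *: Es eta - (opT t^-1 i (Et eta) - c1 *: Et eta)
  = opT t^-1 i (Es eta - Et eta) - c1 *: (Es eta - Et eta).
  by rewrite opTB scalerBr !opprD !opprK addrACA.
apply: msizeB_le; first exact: leq_trans (msize_opT _ _ _) h.
exact: leq_trans (msizeZ_le _ _) h.
Qed.

(** Every nonzero composition is [Phi_comp] of a smaller one, after its last
    nonzero part has been moved to the end by swaps of the kind that the
    recursion for the nonsymmetric polynomials covers. *)
Theorem top_component eta : (msize (Es eta - Et eta) <= mdeg eta)%N.
Proof.
elim: {eta}(mdeg eta) {-2}eta (erefl (mdeg eta)) => [|d IHd] eta hd.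
  move/eqP: (hd); rewrite mdeg_eq0 => /eqP e0; rewrite e0.
  have sz := msize_Es EsP 0%MM; rewrite mdeg0 in sz.
  rewrite (msize1_polyC sz) (Es_coef EsP) mpolyC1.
  by have [_ -> _ _] := EtP; rewrite subrr msize0.
rewrite hd.
have [p hp] : exists p : 'I_n.+1, (0 < eta p)%N.
  apply/existsP; apply: contraT; rewrite negb_exists => /forallP h.
  suff : mdeg eta = 0%N by rewrite hd.
  by rewrite mdegE big1 // => i _; apply/eqP; rewrite -leqn0 leqNgt.
elim: {p}(n - p)%N {-2}p (erefl (n - p)%N) eta hd hp => [|m IHm] p hpm eta hd hp.
  have pm : p = ord_max by apply: ord_inj => /=; have := ltn_ord p; lia.
  rewrite pm in hp; rewrite -(Phi_predK hp).
  have hd' : mdeg (Phi_pred eta) = d by move: hd; rewrite -{1}(Phi_predK hp) mdeg_Phi => -[].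
  by rewrite -hd'; apply: top_Phi; apply: IHd.
have [[i pi]|pm] := ord_lo_or_max p; last by move: hpm; rewrite pm /= subnn.
have hm : (n - hi i)%N = m by move: hpm; rewrite pi /= /bump /=; lia.
have [e|nz] := posnP (eta (hi i)); last exact: IHm hm eta hd nz.
rewrite -[eta](swK i) -[in (_ <= _)%N]hd -(mdeg_sw i); apply: top_sw.
  by rewrite sw_lo sw_hi e -pi.
rewrite mdeg_sw hd; apply: (IHm (hi i)) => //; first by rewrite mdeg_sw.
by rewrite sw_hi -pi.
Qed.

(** * The upper bound on the support *)

(** All other positions come before the last zero part. *)
Lemma leg'_last_zero eta i : eta i = 0%N -> exists j, eta j = 0%N /\ leg' eta j = n.
Proof.
move=> /eqP ei; case: (@arg_maxnP _ i (fun j => eta j == 0%N) (@nat_of_ord _) ei).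
move=> j /eqP ej hj; exists j; split=> //; rewrite leg'E.
rewrite (_ : [set _ | _] = ~: [set j]).
  by have := cardsC [set j]; rewrite cards1 card_ord add1n => -[].
apply/setP => k; rewrite !inE /beats ej.
have := hj k; have := val_eqE k j; rewrite /=; have [/eqP ek|ek] := boolP (eta k == 0%N).
  by move=> <- /(_ isT); rewrite ek; lia.
by move=> <- _; lia.
Qed.

Lemma sp_add_ones eta i : sp (add_ones eta) i = q * sp eta i.
Proof.
rewrite /spectrum mnmE exprS -mulrA; congr (_ * (_ / _ ^+ _)).
by apply: (@leg'_reindex _ _ _ id) => // j; rewrite /beats !mnmE.
Qed.

Definition dilate p : {mpoly F[n.+1]} := subst (fun i => q^-1 *: 'X_i) p.

Lemma dilate_homog p d : p \is d.-homog -> dilate p = q^-1 ^+ d *: p.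
Proof.
move=> /dhomogP hp; rewrite /dilate /subst /mmap [in RHS](mpolyE p) scaler_sumr.
apply: eq_big_seq => m /hp em; rewrite mul_mpolyC scalerA mulrC -scalerA.
congr (_ *: _); rewrite /mmap1 -em -[X in _ ^+ X]/(mdeg m) mdegE expr_sum.
rewrite (eq_bigr (fun i => (q^-1 ^+ m i)%:MP * 'X_i ^+ m i)) => [|i _].
  by rewrite big_split /= -mpolyXE_id -mul_mpolyC rmorph_prod.
by rewrite exprZn mul_mpolyC.
Qed.

Lemma msize_prod_shifted c (r : seq 'I_n.+1) :
  (msize (\prod_(i <- r) ('X_i - c%:MP) : {mpoly F[n.+1]}) <= (size r).+1)%N.
Proof.
elim: r => [|i r IH]; first by rewrite big_nil msize1.
by rewrite big_cons; apply: msizeMX_le; rewrite ?msize_XsubC.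
Qed.

Lemma msize_prod_shifted_sub c (r : seq 'I_n.+1) :
  (msize (\prod_(i <- r) ('X_i - c%:MP) - \prod_(i <- r) 'X_i : {mpoly F[n.+1]})
   <= size r)%N.
Proof.
elim: r => [|i r IH]; first by rewrite !big_nil subrr msize0.
rewrite !big_cons mulrBl addrAC -mulrBr; apply: msizeB_le.
  by apply: msizeMX_le; rewrite ?msizeX ?mdeg1.
by rewrite mul_mpolyC; apply: leq_trans (msizeZ_le _ _) (msize_prod_shifted _ _).
Qed.

Lemma size_index : size (index_enum 'I_n.+1) = n.+1.
Proof. by rewrite -[RHS]card_ord cardT enumT. Qed.

(** The lift is a product of two factors.  The first is the product of the
    z_i - t^(1-N), which vanishes at the nodes with a zero part.  The second is
    E*_eta(z / q), which handles the other nodes, as adding 1 to all parts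
    multiplies the node by q. *)
Lemma below_add_ones eta :
  below q t (add_ones eta) (mdeg eta + n.+1) ((\prod_i 'X_i) * Et eta).
Proof.
set d := mdeg eta; pose c : F := t ^- n.
have -> : (\prod_i 'X_i) * Et eta = q ^+ d *: ((\prod_i 'X_i) * dilate (Et eta)).
  rewrite (dilate_homog (Et_homog eta)) -/d -scalerAr scalerA -exprMn divff //.
  by rewrite expr1n scale1r.
apply: belowZ; have size_dil p k : (msize p <= k)%N -> (msize (dilate p) <= k)%N.
  move=> h; apply: leq_trans (msize_subst _ _) h => i; exact: msize_scaleX.
pose g := (\prod_i ('X_i - c%:MP)) * dilate (Es eta).
have vg mu : mu != add_ones eta -> (mdeg mu <= d + n.+1)%N -> g.@[sp mu] = 0.
  move=> ne le; rewrite /g mevalM.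
  have [/existsP[i /eqP ei]|nz] := boolP [exists i, mu i == 0%N].
    have [j [ej lj]] := leg'_last_zero ei.
    rewrite (bigD1 j) //= mevalM mevalB mevalXU mevalC /spectrum ej lj mul1r.
    by rewrite subrr !mul0r.
  rewrite negb_exists in nz; move/forallP in nz.
  pose nu : 'X_{1..n.+1} := [multinom (mu i).-1 | i < n.+1].
  have e : mu = add_ones nu.
    by apply/mnmP => i; rewrite !mnmE prednK // lt0n.
  rewrite [X in _ * X](_ : _ = 0) ?mulr0 // meval_subst.
  rewrite (@meval_eq _ _ _ (sp nu)); last first.
    by move=> i; rewrite mevalZ mevalXU e sp_add_ones mulKf.
  apply: (Es_vanish EsP).
    by apply: contraNneq ne => <-; rewrite e.
  by move: le; rewrite e mdeg_add_ones leq_add2r.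
exists g; last first.
  by move=> mu hmu ns; apply: vg; rewrite ?hmu //; apply: contraNneq ns => ->; apply: succ_refl.
have szE := size_dil _ _ (msize_Es EsP eta).
split.
- have := msizeM_bound (msize_prod_shifted c (index_enum 'I_n.+1)) szE.
  by rewrite size_index addnC addSn.
- have -> : g - (\prod_i 'X_i) * dilate (Et eta)
    = (\prod_i ('X_i - c%:MP) - \prod_i 'X_i) * dilate (Es eta)
      + (\prod_i 'X_i) * dilate (Es eta - Et eta).
    by rewrite /g [dilate (_ - _)]substB mulrBl mulrBr addrA subrK.
  apply: msizeDl_le.
    have := msize_prod_shifted_sub c (index_enum 'I_n.+1); rewrite size_index => h.
    by rewrite addnC addSnnS; apply: msizeM_bound h szE.
  have := msize_prodX (index_enum 'I_n.+1) (size_dil _ _ (top_component eta)).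
  by rewrite size_index addnC.
- move=> mu hmu; apply: vg; last exact: ltnW.
  by apply: contraTneq hmu => ->; rewrite mdeg_add_ones ltnn.
Qed.

(** Each term z_J E'_eta gives e_N E'_eta when multiplied by the variables
    outside J. *)
Lemma below_mesym r eta : (r <= n.+1)%N ->
  below q t (add_ones eta) (mdeg eta + r) (mesym n.+1 F r * Et eta).
Proof.
move=> hr; rewrite /mesym mulr_suml; apply: below_sum => J /eqP cJ.
have szJ : size (enum (~: J)) = (n.+1 - r)%N.
  by rewrite -cardE cardsCs setCK card_ord cJ.
have eJ : \prod_(i in J) 'X_i = \prod_(i <- enum J) 'X_i :> {mpoly F[n.+1]}.
  by rewrite big_enum.
apply: (below_div_prodX q0 t0 qt_indep EsP (r := enum (~: J))).
  have := msize_prodX (enum J) (msize_Et eta).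
  by rewrite -eJ -cardE cJ addnS addnC.
rewrite big_enum /= szJ (_ : (_ + (_ + _))%N = (mdeg eta + n.+1)%N); last by lia.
rewrite mulrA (_ : _ * \prod_(i in J) 'X_i = \prod_i 'X_i).
  exact: below_add_ones.
rewrite [RHS](bigID (mem J)) /= mulrC; congr (_ * _).
by apply: eq_bigl => i; rewrite inE.
Qed.

(** * The Pieri formula *)

Lemma sum_bmultinom (b b' : nat) (P : pred 'X_{1..n.+1}) (G : 'X_{1..n.+1} -> F) :
    (b <= b')%N -> (forall mu, P mu -> (mdeg mu <= b)%N) ->
  \sum_(mu : 'X_{1..n.+1 < b.+1} | P mu) G mu
  = \sum_(mu : 'X_{1..n.+1 < b'.+1} | P mu) G mu.
Proof.
move=> bb hP.
pose h (mu : 'X_{1..n.+1 < b.+1}) : 'X_{1..n.+1 < b'.+1} :=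
  BMultinom (leq_trans (bmdeg mu) (bb : (b.+1 <= b'.+1)%N)).
pose h' (mu : 'X_{1..n.+1 < b'.+1}) : 'X_{1..n.+1 < b.+1} :=
  insubd (@bm0 n.+1 b) (val mu).
rewrite [RHS](reindex_onto h h') => [|mu hmu]; last first.
  by apply: val_inj; rewrite /= insubdK // unfold_in /= ltnS hP.
apply: eq_bigl => mu; rewrite /= -[P mu in LHS]andbT; congr (_ && _).
by apply/esym/eqP/val_inj; rewrite insubdK // unfold_in /=; apply: (bmdeg mu).
Qed.

Section Expansion.
Variables (r : nat) (hr : (1 <= r <= n.+1)%N) (eta : 'X_{1..n.+1}).
Variable A : 'X_{1..n.+1} -> F.
Hypothesis hA :
  (mesym n.+1 F r - ((mesym n.+1 F r).@[sp eta])%:MP) * Es eta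
  = \sum_(la : 'X_{1..n.+1 < (mdeg eta + r).+1}
            | (mdeg eta + 1 <= mdeg la <= mdeg eta + r)%N) A la *: Es la.

Local Notation e_r := (mesym n.+1 F r).
Local Notation d := (mdeg eta).

(** At the node of [mu], the terms of the expansion with a modulus at least that
    of [mu] vanish, apart from the one for [mu]. *)
Lemma expansion_at_node mu (hmu : (mdeg mu < (d + r).+1)%N) : (d < mdeg mu)%N ->
  (e_r.@[sp mu] - e_r.@[sp eta]) * (Es eta).@[sp mu]
  = A mu * (Es mu).@[sp mu]
    + \sum_(la : 'X_{1..n.+1 < (d + r).+1} | (d < mdeg la < mdeg mu)%N)
        A la * (Es la).@[sp mu].
Proof.
move=> hd; have := congr1 (meval (sp mu)) hA.
rewrite mevalM mevalB mevalC => ->; rewrite meval_sum.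
rewrite (bigD1 (BMultinom hmu)) /=; last by rewrite addn1 hd -ltnS.
rewrite mevalZ; congr (_ + _); rewrite big_mkcond [RHS]big_mkcond /=.
apply: eq_bigr => la _; have := bmdeg la; rewrite ltnS addn1 => ->.
rewrite andbT mevalZ bmeqP /=.
have [e|ne] := eqVneq (val la) mu; first by rewrite e ltnn !andbF.
have [_|_] := boolP (d < mdeg la)%N => //=; have [//|le] := ltnP (mdeg la) (mdeg mu).
by rewrite (Es_vanish EsP) ?mulr0 // eq_sym.
Qed.

(** By strong induction on the modulus: at the node of [mu], the left-hand side
    of the expansion vanishes by extra vanishing, and so does every smaller term,
    either because its coefficient does by induction or because its index does
    not precede [mu]. *)
Lemma coef_lower mu : (d < mdeg mu <= d + r)%N -> ~~ succ' eta mu -> A mu = 0.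
Proof.
elim: {mu}(mdeg mu).+1 {-2}mu (ltnSn (mdeg mu)) => // m IH mu; rewrite ltnS => hm.
move=> /andP[hd hr'] ns; have := @expansion_at_node mu hr' hd.
rewrite (extra_vanishing q0 t0 qt_indep EsP ns) mulr0 big1 => [|la /andP[h1 h2]].
  rewrite addr0 => /esym/eqP; rewrite mulf_eq0.
  by rewrite (negbTE (Es_node q0 t0 qt_indep EsP mu)) orbF => /eqP.
have [sl|nsl] := boolP (succ' eta la); last first.
  by rewrite IH ?mul0r ?(leq_trans h2) // h1 -ltnS bmdeg.
rewrite (extra_vanishing q0 t0 qt_indep EsP) ?mulr0 //.
by apply: contra ns; apply: succ_trans.
Qed.

(** The terms that the recursion omits have a zero coefficient or a zero value at
    [la], by [coef_lower] and [extra_vanishing]. *)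
Theorem coef_recursion la : mdeg la = (d + r)%N ->
  A la = (e_r.@[sp la] - e_r.@[sp eta]) * (Es eta).@[sp la] / (Es la).@[sp la]
    - \sum_(1 <= k < r)
        \sum_(mu : 'X_{1..n.+1 < (d + k).+1}
                | [&& mdeg mu == (d + k)%N, succ' eta mu & succ' mu la])
          A mu * ((Es mu).@[sp la] / (Es la).@[sp la]).
Proof.
move=> hla; have hl : (mdeg la < (d + r).+1)%N by rewrite hla.
have r0 : (0 < r)%N by case/andP: hr.
have hd : (d < mdeg la)%N by rewrite hla -[X in (X < _)%N]addn0 ltn_add2l.
have E0 := Es_node q0 t0 qt_indep EsP la.
rewrite (expansion_at_node hl hd) mulrDl mulfK //; set S := \sum_(1 <= k < r) _.
suff -> : (\sum_(mu : 'X_{1..n.+1 < (d + r).+1} | (d < mdeg mu < mdeg la)%N)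
    A mu * (Es mu).@[sp la]) / (Es la).@[sp la] = S by rewrite addrK.
pose G mu := A mu * ((Es mu).@[sp la] / (Es la).@[sp la]).
pose P k mu := [&& mdeg mu == (d + k)%N, succ' eta mu & succ' mu la].
have -> : S = \sum_(1 <= k < r) \sum_(mu : 'X_{1..n.+1 < (d + r).+1})
    (if P k mu then G mu else 0).
  apply: eq_big_nat => k /andP[_ kr]; rewrite -big_mkcond.
  apply: (@sum_bmultinom _ _ (P k) G); first by rewrite leq_add2l ltnW.
  by move=> mu /andP[/eqP ->].
rewrite exchange_big mulr_suml big_mkcond /=; apply: eq_bigr => mu _.
have [range|nrange] := boolP (d < mdeg mu < mdeg la)%N; last first.
  rewrite big_nat_cond big1 // => k /andP[/andP[k1 kr] _].
  case: ifP => // /andP[/eqP e _]; move: nrange.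
  by rewrite e hla ltn_add2l kr -[X in (X < _)%N]addn0 ltn_add2l k1.
have [mu1 mu2] := andP range.
have [s12|ns] := boolP (succ' eta mu && succ' mu la); last first.
  rewrite big1 => [|k _]; last by rewrite /P (negbTE ns) andbF.
  move: ns; rewrite negb_and => /orP[ns|ns].
    by rewrite coef_lower ?mul0r // mu1 -ltnS (bmdeg mu).
  by rewrite (extra_vanishing q0 t0 qt_indep EsP ns) mulr0 mul0r.
have kin : (mdeg mu - d)%N \in index_iota 1 r.
  by rewrite mem_index_iota; move: mu2; rewrite hla; lia.
rewrite (bigD1_seq _ kin (iota_uniq _ _)) /= big1 => [|k ne].
  by rewrite /P s12 subnKC ?(ltnW mu1) // eqxx addr0 /G mulrA.
rewrite /P; case: eqP => // e; move: ne; rewrite e addKn eqxx //.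
Qed.

(** The part of modulus |eta| + r of the expansion lifts e_r E'_eta, so its values
    at the nodes, hence its coefficients, vanish outside the support given by
    [below_mesym]. *)
Theorem pieri_nonsymmetric : e_r * Et eta
  = \sum_(la : 'X_{1..n.+1 < (d + r).+1}
          | [&& mdeg la == (d + r)%N, succ' eta la & succ' la (add_ones eta)])
      A la *: Et la.
Proof.
have /andP[r1 rn] := hr; set D := (d + r)%N.
have dD : (d < D)%N by rewrite /D; lia.
pose G := \sum_(la : 'X_{1..n.+1 < D.+1} | mdeg la == D) A la *: Es la.
pose G' := \sum_(la : 'X_{1..n.+1 < D.+1} | mdeg la == D) A la *: Et la.
have er_homog : e_r \is r.-homog.
  by apply/dhomogP => m; rewrite mem_msupp_mesym /mechar => /andP[/eqP].
have er_size : (msize e_r <= r.+1)%N := msize_dhomog er_homog.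
have GG' : (msize (G - G') <= D)%N.
  rewrite /G /G' -sumrB; apply: leq_trans (msize_sum _ _ _) _.
  apply/bigmax_leqP_seq => la _ /eqP e; rewrite -scalerBr.
  by apply: leq_trans (msizeZ_le _ _) _; have := top_component la; rewrite e.
have GE : (msize (G - e_r * Et eta) <= D)%N.
  pose L := \sum_(la : 'X_{1..n.+1 < D.+1} | (d < mdeg la < D)%N) A la *: Es la.
  have eG : e_r * Es eta = G + (L + (e_r.@[sp eta]) *: Es eta).
    rewrite -mul_mpolyC addrA -[LHS](subrK ((e_r.@[sp eta])%:MP * Es eta)).
    rewrite -mulrBl hA; congr (_ + _).
    rewrite (bigID (fun la : 'X_{1..n.+1 < D.+1} => mdeg la == D)) /=.
    congr (_ + _); apply: eq_bigl => la; have := bmdeg la; rewrite -/D; lia.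
  have -> : G - e_r * Et eta = e_r * (Es eta - Et eta) - (L + e_r.@[sp eta] *: Es eta).
    by rewrite mulrBr eG [RHS]addrAC [G + _ - _]addrK.
  apply: msizeB_le.
    by rewrite /D addnC; apply: msizeM_bound er_size (top_component _).
  apply: msizeDl_le; last first.
    apply: leq_trans (msizeZ_le _ _) (leq_trans (msize_Es EsP _) dD).
  apply: leq_trans (msize_sum _ _ _) _; apply/bigmax_leqP_seq => la _ /andP[_ lt].
  by apply: leq_trans (msizeZ_le _ _) (leq_trans (msize_Es EsP _) lt).
have -> : e_r * Et eta = G'.
  apply/eqP; rewrite -subr_eq0; apply/eqP; apply: (@dhomog_small _ D).
    rewrite rpredB //; first by rewrite /D addnC dhomogM ?Et_homog.
    apply: rpred_sum => la /eqP e; apply: rpredZ; have := Et_homog la; by rewrite e.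
  have -> : e_r * Et eta - G' = (G - G') - (G - e_r * Et eta).
    by rewrite [RHS]addrC opprB addrA subrK.
  exact: msizeB_le.
rewrite /G' [RHS]big_mkcond [LHS]big_mkcond /=; apply: eq_bigr => la _.
have [e|//] := eqVneq (mdeg la) D.
have [sl|nsl] /= := boolP (succ' eta la); last first.
  by rewrite coef_lower ?scale0r // e leqnn dD.
have [su|nsu] //= := boolP (succ' la (add_ones eta)).
have [g hg vg] := below_mesym eta rn.
have hG : node_lift q t D (e_r * Et eta) G.
  split=> //; first exact: (msize_level EsP).
  by move=> mu; apply: (level_vanish EsP).
have := vg la e nsu; rewrite (lift_unique q0 t0 qt_indep hg hG).
rewrite (level_node EsP _ e) => /eqP; rewrite mulf_eq0.
by rewrite (negbTE (Es_node q0 t0 qt_indep EsP la)) orbF => /eqP ->; rewrite scale0r.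
Qed.

End Expansion.

End Pieri.

(** * The automorphism inverting both parameters *)

Section Transport.

Variables (F : fieldType) (phi : {rmorphism F -> F}) (n : nat).
Local Notation map := (@map_mpoly n.+1 F F phi).

Lemma map_msym (s : 'S_n.+1) p : map (msym s p) = msym s (map p).
Proof.
apply/mpolyP => m; rewrite (mcoeff_sym (map p)) [RHS]mcoeff_map_mpoly.
by rewrite [LHS]mcoeff_map_mpoly (mcoeff_sym p).
Qed.

Lemma map_X (i : 'I_n.+1) : map 'X_i = 'X_i. Proof. exact: map_mpolyX. Qed.

Lemma map_scale c p : map (c *: p) = phi c *: map p.
Proof. exact: map_mpolyZ. Qed.

Lemma mapD p p' : map (p + p') = map p + map p'. Proof. exact: rmorphD. Qed.
Lemma mapB p p' : map (p - p') = map p - map p'. Proof. exact: rmorphB. Qed.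
Lemma mapM p p' : map (p * p') = map p * map p'. Proof. exact: rmorphM. Qed.

Lemma map_divdiff (a b : 'I_n.+1) p : a != b ->
  map (divdiff a b p) = divdiff a b (map p).
Proof.
move=> ab; apply/esym/divdiff_unique => //.
by have := congr1 map (divdiffP a b p); rewrite mapM !mapB !map_X map_msym.
Qed.

Lemma map_opT t i p : map (opT t i p) = opT (phi t) i (map p).
Proof.
by rewrite /opT mapD map_scale mapM mapB map_scale !map_X map_divdiff ?lo_neq_hi.
Qed.

Lemma map_opTinv t i p : map (opTinv t i p) = opTinv (phi t) i (map p).
Proof.
by rewrite /opTinv mapD !map_scale map_opT rmorphB rmorph1 fmorphV.
Qed.

Lemma map_Phiq t p : map (Phiq t p) = Phiq (phi t) (map p).
Proof.
rewrite /Phiq mapM map_X; congr (_ * _).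
by elim: (enum 'I_n) p => [|i s IH] p //=; rewrite IH map_opTinv.
Qed.

Lemma map_spectrum q t (eta : 'X_{1..n.+1}) i :
  phi (spectrum q t eta i) = spectrum (phi q) (phi t) eta i.
Proof. by rewrite /spectrum rmorphM fmorphV !rmorphXn. Qed.

Lemma map_nonsymmetric_Macdonald q t (E : 'X_{1..n.+1} -> {mpoly F[n.+1]}) :
  nonsymmetric_Macdonald q t E ->
  nonsymmetric_Macdonald (phi q) (phi t) (fun eta => map (E eta)).
Proof.
case=> h1 h2 h3 h4; split.
- move=> eta; have [h e] := h1 eta; split.
    apply/dhomogP => m; rewrite mcoeff_msupp mcoeff_map_mpoly => nz.
    apply/eqP; apply: contraNT nz => ne.
    by rewrite (dhomog_nemf_coeff h ne); apply/eqP; apply: rmorph0.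
  by rewrite mcoeff_map_mpoly e; apply: rmorph1.
- by rewrite h2; apply: rmorph1.
- by move=> eta; rewrite -map_Phiq h3 map_scale fmorphV rmorphXn.
- move=> eta i a b delta lt; rewrite -map_opT (h4 eta i lt) mapD !map_scale.
  by rewrite fmorph_div !rmorphB !rmorph1 fmorphV fmorph_div !map_spectrum.
Qed.

End Transport.

Section Inversion.

Local Notation P2 := {mpoly rat[2]}.
Local Notation "x %:F" := (@FracField.tofrac _ x) (at level 1, format "x %:F").

Lemma Qqt_repr (x : Qqt) : x * (\d_(repr x))%:F = (\n_(repr x))%:F.
Proof.
rewrite -{1}[x]reprK; unlock FracField.tofrac; rewrite -[LHS]FracField.pi_mul.
have d0 := denom_ratioP (repr x).
apply/eqmodP/eqP; rewrite /FracField.mulf /=.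
rewrite !(numer_Ratio _ (oner_neq0 _)) !(denom_Ratio _ (oner_neq0 _)) !mulr1.
by rewrite numer_Ratio // denom_Ratio // mulrC.
Qed.

Let scal : {rmorphism rat -> Qqt} := @FracField.tofrac P2 \o @mpolyC 2 rat.
Let ev : P2 -> Qqt := mmap scal (fun i : 'I_2 => (('X_i : P2)%:F : Qqt)^-1).

Lemma qt_eval_invE p : qt_eval_inv p = ev p.
Proof. by []. Qed.

Lemma qt_eval_inv1 : qt_eval_inv 1 = 1. Proof. exact: (rmorph1 ev). Qed.
Lemma qt_eval_invB : {morph qt_eval_inv : a b / a - b}.
Proof. exact: (rmorphB ev). Qed.
Lemma qt_eval_invM : {morph qt_eval_inv : a b / a * b}.
Proof. exact: (rmorphM ev). Qed.

(** Multiplication by a high power of q t turns p(q^-1, t^-1) into a polynomial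
    with the same coefficients at reflected exponents. *)
Lemma qt_eval_inv_neq0 p : p != 0 -> qt_eval_inv p != 0.
Proof.
rewrite qt_eval_invE; apply: contraNneq => e0; set k := msize p.
pose rv (m : 'X_{1..2}) : 'X_{1..2} := [multinom (k - m i)%N | i < 2].
pose p' : P2 := \sum_(m : 'X_{1..2 < k}) p@_m *: 'X_[rv m].
have p'0 : p' = 0.
  apply/eqP; rewrite -(tofrac_eq0 p'); apply/eqP.
  pose w : Qqt := ('X_[ [multinom k | i < 2] ] : P2)%:F.
  transitivity (w * ev p); last by rewrite e0 mulr0.
  rewrite /ev (mmapE k) ?leqnn // mulr_sumr /p' rmorph_sum /=.
  apply: eq_bigr => m _; rewrite -mul_mpolyC tofracM mulrCA; congr (_ * _).
  have mk i : (m i <= k)%N.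
    apply: leq_trans (ltnW (bmdeg m)); rewrite mdegE (bigD1 i) //=.
    exact: leq_addr.
  rewrite /w /mmap1 !mpolyXE_id !rmorph_prod /= -big_split /=.
  apply: eq_bigr => i _; rewrite !mnmE !rmorphXn /= exprVn.
  have X0 : ('X_i : P2)%:F != 0 by rewrite tofrac_eq0 -msize_poly_eq0 msizeX.
  by apply: (canRL (mulfK (expf_neq0 _ X0))); rewrite -exprD subnK.
have rv_inj (m m' : 'X_{1..2 < k}) : rv m = rv m' -> m = m'.
  move=> /mnmP e; apply/val_inj/mnmP => i; have := e i; rewrite !mnmE.
  have bd (l : 'X_{1..2 < k}) : (l i <= k)%N.
    apply: leq_trans (ltnW (bmdeg l)); rewrite mdegE (bigD1 i) //=.
    exact: leq_addr.
  by have := bd m; have := bd m'; rewrite /=; lia.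
apply/eqP/mpolyP => m; rewrite mcoeff0; have [hm|hm] := ltnP (mdeg m) k; last first.
  by apply: memN_msupp_eq0; apply: msize_mdeg_ge.
have := congr1 (mcoeff (rv (BMultinom hm))) p'0.
rewrite mcoeff0 /p' raddf_sum (bigD1 (BMultinom hm)) //= mcoeffZ mcoeffX eqxx.
rewrite mulr1 big1 ?addr0 // => m' ne; rewrite mcoeffZ mcoeffX.
case: eqP => [/(rv_inj m' (BMultinom hm)) e|_]; last by rewrite mulr0.
by rewrite e eqxx in ne.
Qed.

Lemma qt_inv_frac (x : Qqt) a b : b != 0 -> x * b%:F = a%:F ->
  qt_inv x = qt_eval_inv a / qt_eval_inv b.
Proof.
move=> b0 e; have d0 := denom_ratioP (repr x).
have ab : \n_(repr x) * b = a * \d_(repr x).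
  apply/eqP; rewrite -tofrac_eq !tofracM -e -Qqt_repr; apply/eqP; exact: mulrAC.
rewrite /qt_inv; apply/eqP; rewrite eqr_div ?qt_eval_inv_neq0 //.
by rewrite -!qt_eval_invM ab.
Qed.

Lemma qt_inv_tofrac a : qt_inv a%:F = qt_eval_inv a.
Proof.
rewrite (@qt_inv_frac _ a 1) ?oner_neq0 ?tofrac1 ?mulr1 //.
by rewrite qt_eval_inv1 divr1.
Qed.

Lemma qt_inv_is_zmod : zmod_morphism qt_inv.
Proof.
move=> x y; have dx := denom_ratioP (repr x); have dy := denom_ratioP (repr y).
rewrite (@qt_inv_frac _ (\n_(repr x) * \d_(repr y) - \n_(repr y) * \d_(repr x))
  (\d_(repr x) * \d_(repr y))) ?mulf_neq0 //; last first.
  rewrite tofracB !tofracM mulrBl -!Qqt_repr; congr (_ - _); first exact: mulrA.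
  by rewrite [_%:F * _%:F]mulrC mulrA.
have := qt_eval_inv_neq0 dx; have := qt_eval_inv_neq0 dy.
rewrite /qt_inv qt_eval_invB !qt_eval_invM => ey ex.
have lin (K : fieldType) (a b c e : K) : b != 0 -> e != 0 ->
  (a * e - c * b) / (b * e) = a / b - c / e by move=> b0 e0; field; rewrite b0 e0.
exact: lin.
Qed.

Lemma qt_inv_is_monoid : monoid_morphism qt_inv.
Proof.
split; first by rewrite -[in LHS]tofrac1 qt_inv_tofrac qt_eval_inv1.
move=> x y; have dx := denom_ratioP (repr x); have dy := denom_ratioP (repr y).
rewrite (@qt_inv_frac _ (\n_(repr x) * \n_(repr y)) (\d_(repr x) * \d_(repr y))).
- by rewrite /qt_inv mulf_div !qt_eval_invM.
- by rewrite mulf_neq0.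
- by rewrite !tofracM -!Qqt_repr mulrACA.
Qed.

HB.instance Definition _ := GRing.isZmodMorphism.Build Qqt Qqt qt_inv qt_inv_is_zmod.
HB.instance Definition _ := GRing.isMonoidMorphism.Build Qqt Qqt qt_inv qt_inv_is_monoid.

Lemma qt_inv_qvar : qt_inv qvar = qvar^-1.
Proof. by rewrite qt_inv_tofrac qt_eval_invE /ev mmapX mmap1U. Qed.

Lemma qt_inv_tvar : qt_inv tvar = tvar^-1.
Proof. by rewrite qt_inv_tofrac qt_eval_invE /ev mmapX mmap1U. Qed.

Lemma mpolyX_neq0 (i : 'I_2) : ('X_i : P2) != 0.
Proof. by rewrite -msize_poly_eq0 msizeX. Qed.

Lemma qvar_neq0 : qvar != 0. Proof. by rewrite tofrac_eq0 mpolyX_neq0. Qed.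
Lemma tvar_neq0 : tvar != 0. Proof. by rewrite tofrac_eq0 mpolyX_neq0. Qed.

Lemma qtvar_indep (a b c d : nat) :
  qvar ^+ a * tvar ^+ b = qvar ^+ c * tvar ^+ d -> a = c /\ b = d.
Proof.
rewrite /qvar /tvar -!tofracXn -!tofracM => /eqP; rewrite tofrac_eq.
rewrite !mpolyXn -!mpolyXD => /eqP/(congr1 (mcoeff (U_(ord0) *+ c + U_(ord_max) *+ d)%MM)).
rewrite !mcoeffX eqxx; case: eqP => [/mnmP e _|_ /eqP]; last by rewrite eq_sym oner_eq0.
have := e ord0; have := e ord_max; rewrite !mnmDE !mulmnE !mnm1E /=.
by lia.
Qed.

End Inversion.

Theorem corollary6 (n r : nat) (hr : (1 <= r <= n.+1)%N)
    (Estar E : 'X_{1..n.+1} -> {mpoly Qqt[n.+1]})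
    (hEstar : forall eta, interpolation_Macdonald qvar tvar eta (Estar eta))
    (hE : nonsymmetric_Macdonald qvar tvar E)
    (eta : 'X_{1..n.+1}) (A : 'X_{1..n.+1} -> Qqt)
    (hA : (mesym n.+1 Qqt r
             - ((mesym n.+1 Qqt r).@[spectrum qvar tvar eta])%:MP) * Estar eta
          = \sum_(la : 'X_{1..n.+1 < (mdeg eta + r).+1}
                  | (mdeg eta + 1 <= mdeg la <= mdeg eta + r)%N)
              A la *: Estar la) :
  mesym n.+1 Qqt r * inv_params (E eta)
  = \sum_(la : 'X_{1..n.+1 < (mdeg eta + r).+1}
          | [&& mdeg la == (mdeg eta + r)%N, succ' eta la
              & succ' la (add_ones eta)])
      A la *: inv_params (E la)
  /\
  (forall la : 'X_{1..n.+1},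
     mdeg la = (mdeg eta + r)%N -> succ' eta la -> succ' la (add_ones eta) ->
     A la
     = ((mesym n.+1 Qqt r).@[spectrum qvar tvar la]
          - (mesym n.+1 Qqt r).@[spectrum qvar tvar eta])
         * (Estar eta).@[spectrum qvar tvar la]
         / (Estar la).@[spectrum qvar tvar la]
       - \sum_(1 <= k < r)
           \sum_(mu : 'X_{1..n.+1 < (mdeg eta + k).+1}
                 | [&& mdeg mu == (mdeg eta + k)%N, succ' eta mu & succ' mu la])
             A mu * ((Estar mu).@[spectrum qvar tvar la]
                     / (Estar la).@[spectrum qvar tvar la])).
Proof.
have hE' : nonsymmetric_Macdonald qvar^-1 tvar^-1 (fun eta => inv_params (E eta)).
  by rewrite -qt_inv_qvar -qt_inv_tvar; apply: map_nonsymmetric_Macdonald.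
split.
  exact: (pieri_nonsymmetric qvar_neq0 tvar_neq0 qtvar_indep hEstar hE' hr hA).
move=> la hla _ _.
exact: (coef_recursion qvar_neq0 tvar_neq0 qtvar_indep hEstar hr hA).
Qed.
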